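(* For every $d\in\mathbb{N}\cup\{\infty\}$, the Bohr set of the multiplier algebra $\mathrm{Mult}(H^2_d)$ of the Drury--Arveson space $H^2_d$ equals \[\left\{ z\in\mathbb{B}_d \,:\, \|z\|_{\ell^2}\le\frac13\right\}.\]
   Context: Here $\mathbb{N}=\{1,2,3,\ldots\}$. For $d\in\mathbb{N}\cup\{\infty\}$, $\mathbb{B}_d$ is the open unit ball of $\mathbb{C}^d$ with the Euclidean ($\ell^2$) norm, where $\mathbb{C}^d$ is understood as $\ell^2$ when $d=\infty$; $\langle z,w\rangle_d$ denotes the standard inner product. The Drury--Arveson space $H^2_d$ is the reproducing kernel Hilbert space on $\mathbb{B}_d$ with kernel \[k_d(z,w)=\frac{1}{1-\langle z,w\rangle_d}.\] The monomials $z^\gamma=\prod_j z_j^{\gamma_j}$, where $\gamma=(\gamma_j)_{j=1}^d$ ranges over the finitely supported multi-indices of nonnegative integers, form an orthogonal basis of $H^2_d$, and every $F\in H^2_d$ has a unique monomial expansion $F(z)=\sum_\gamma a_\gamma z^\gamma$, absolutely convergent in $\mathbb{B}_d$. $\mathrm{Mult}(H^2_d)$ is the algebra of functions $\Phi$ on $\mathbb{B}_d$ such that $M_\Phi:F\mapsto\Phi F$ is a bounded linear operator on $H^2_d$, with $\|\Phi\|_{\mathrm{Mult}(H^2_d)}=\|M_\Phi\|$; since $1\in H^2_d$, one has $\mathrm{Mult}(H^2_d)\subseteq H^2_d$. For $\Phi(z)=\sum_\gamma a_\gamma z^\gamma$ in $\mathrm{Mult}(H^2_d)$ the majorant is $M\Phi(z)=\sum_\gamma|a_\gamma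 z^\gamma|$, and the Bohr set of $\mathrm{Mult}(H^2_d)$ is the set of all $z\in\mathbb{B}_d$ such that $M\Phi(z)\le\|\Phi\|_{\mathrm{Mult}(H^2_d)}$ for every $\Phi\in\mathrm{Mult}(H^2_d)$. *)

(* Defs.v *)
From mathcomp Require Import all_boot all_order all_algebra finmap complex.
From mathcomp Require Import all_classical all_reals all_analysis.
From mathcomp.analysis Require showcase.summability.

Set Implicit Arguments.
Unset Strict Implicit.
Unset Printing Implicit Defensive.

Import Order.TTheory GRing.Theory Num.Theory numFieldNormedType.Exports.
Import Normc.

Local Open Scope classical_set_scope.
Local Open Scope ring_scope.
Local Open Scope complex_scope.

(** [Some n] is the finite dimension [n] and [None] is infinity. *)
Definition axis (d : option nat) : choiceType :=
  if d is Some n then ('I_n : choiceType) else (nat : choiceType).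

(** Unordered sum, the limit of the finite partial sums along the directed set
    of finite subsets of [I]; [R[i]^o] carries the norm topology of [R[i]]. *)
Definition csum (R : realType) (I : choiceType) (f : I -> R[i]) : R[i] :=
  summability.sum (f : I -> R[i]^o).

Section Ball.
Context (R : realType) (J : choiceType).

Definition l2sum (z : J -> R[i]) : \bar R :=
  \esum_(j in [set: J]) (normc (z j) ^+ 2)%:E.

Definition l2norm (z : J -> R[i]) : R := Num.sqrt (fine (l2sum z)).

(** The first conjunct is needed because [fine +oo = 0]. *)
Definition l2ball : set (J -> R[i]) :=
  [set z | (l2sum z < +oo)%E /\ l2norm z < 1].

Definition inner (z w : J -> R[i]) : R[i] := csum (fun j => z j * conjc (w j)).

Definition da_kernel (z w : l2ball) : R[i] := 1 / (1 - inner (val z) (val w)).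

End Ball.
Arguments l2ball : clear implicits.
Arguments da_kernel : clear implicits.

Section RKHS.
Context (R : realType) (X : Type).
Implicit Types f g h : X -> R[i].

Definition ip_norm (ip : (X -> R[i]) -> (X -> R[i]) -> R[i]) f : R :=
  Num.sqrt (complex.Re (ip f f)).

(** [rkhs_ip] is an arbitrary total function of which only the restriction to
    [rkhs_fun] matters. *)
Record rkhs (k : X -> X -> R[i]) := Rkhs {
  rkhs_fun : set (X -> R[i]) ;
  rkhs_ip : (X -> R[i]) -> (X -> R[i]) -> R[i] ;
  rkhs_0 : rkhs_fun 0 ;
  rkhs_lin : forall a f g, rkhs_fun f -> rkhs_fun g -> rkhs_fun (a *: f + g) ;
  rkhs_ip_lin : forall a f g h, rkhs_fun f -> rkhs_fun g -> rkhs_fun h ->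
    rkhs_ip (a *: f + g) h = a * rkhs_ip f h + rkhs_ip g h ;
  rkhs_ip_conj : forall f g, rkhs_fun f -> rkhs_fun g ->
    rkhs_ip f g = conjc (rkhs_ip g f) ;
  rkhs_ip_ge0 : forall f, rkhs_fun f -> 0 <= rkhs_ip f f ;
  rkhs_ip_eq0 : forall f, rkhs_fun f -> rkhs_ip f f = 0 -> f = 0 ;
  rkhs_complete : forall u : nat -> X -> R[i],
    (forall n, rkhs_fun (u n)) ->
    (forall e : R, 0 < e -> exists N, forall m n, (N <= m)%N -> (N <= n)%N ->
      ip_norm rkhs_ip (u m - u n) < e) ->
    exists2 f, rkhs_fun f &
      ip_norm rkhs_ip (u n - f) @[n --> \oo] --> (0 : R) ;
  rkhs_kernel : forall x, rkhs_fun (k ^~ x) ;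
  rkhs_reproducing : forall f x, rkhs_fun f -> rkhs_ip f (k ^~ x) = f x
}.

Context (k : X -> X -> R[i]) (H : rkhs k).

Definition rkhs_norm f : R := ip_norm (rkhs_ip H) f.

Definition multiplier (Phi : X -> R[i]) : Prop :=
  (forall f, rkhs_fun H f -> rkhs_fun H (Phi \* f)) /\
  exists c : R, forall f, rkhs_fun H f -> rkhs_norm (Phi \* f) <= c * rkhs_norm f.

Definition mult_norm (Phi : X -> R[i]) : R :=
  sup [set rkhs_norm (Phi \* f) | f in [set f | rkhs_fun H f /\ rkhs_norm f <= 1]].

End RKHS.

Notation drury_arveson R J := (rkhs (da_kernel R J)).

Section Bohr.
Context (R : realType) (J : choiceType).

Notation multi_index := {fsfun J -> nat with 0%N}.

Definition monomial (z : J -> R[i]) (g : multi_index) : R[i] :=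
  \prod_(j <- finsupp g) z j ^+ g j.

Definition expansion (F : l2ball R J -> R[i]) (a : multi_index -> R[i]) : Prop :=
  forall z : l2ball R J,
    summable [set: multi_index]
      (fun g => (normc (a g * monomial (val z) g))%:E) /\
    F z = csum (fun g => a g * monomial (val z) g).

(** The coefficients of the monomial expansion, which exists and is unique for
    every function in the Drury-Arveson space; zero if there is none. *)
Definition coefs (F : l2ball R J -> R[i]) : multi_index -> R[i] :=
  xget (fun=> 0) [set a | expansion F a].

Definition majorant (F : l2ball R J -> R[i]) (z : l2ball R J) : \bar R :=
  \esum_(g in [set: multi_index]) (normc (coefs F g * monomial (val z) g))%:E.

Definition bohr_set (H : drury_arveson R J) : set (l2ball R J) :=
  [set z | forall Phi, multiplier H Phi ->
    (majorant Phi z <= (mult_norm H Phi)%:E)%E].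

End Bohr.

(* Main.v *)
(** With [m g] the multinomial coefficient of [g], the kernel is
    [k z w = \sum_g m g * z^g * conjc (w^g)], so the monomials lie in [H] and the
    coefficient of [F] at [g] is [m g * <F, z^g>].

    If [Phi] multiplies [H] with norm [c] and [p] is homogeneous of degree [n > 0],
    compressing the multiplication to the span of [1] and [p] gives a lower
    triangular matrix with diagonal [Phi 0], whence
    [c * |<Phi, p>| <= (c ^ 2 - |Phi 0| ^ 2) * |p|]. Choosing the phases of the
    coefficients of [p], the terms of degree [n] of the majorant at [z] add up to
    at most [(c - |Phi 0| ^ 2 / c) * |z| ^ n], and the geometric series with ratio
    1/3 concludes as in the disc.

    Conversely, if [|z| > 1/3] and [u] is the unit vector along [z], the functions
    [(a - <x, u>) / (1 - a * <x, u>)] are contractive multipliers whose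
    majorant at [z] exceeds 1 for [a] close enough to 1. *)

Require Import Defs.
From mathcomp Require Import all_boot all_order all_algebra finmap complex.
From mathcomp Require Import all_classical all_reals all_analysis.
From mathcomp.analysis Require showcase.summability.
From mathcomp Require Import ring lra zify.

Set Implicit Arguments.
Unset Strict Implicit.
Unset Printing Implicit Defensive.

Import Order.TTheory GRing.Theory Num.Theory numFieldNormedType.Exports.
Import Normc.

Local Open Scope classical_set_scope.
Local Open Scope ring_scope.
Local Open Scope complex_scope.

Local Notation Re := complex.Re.
Local Notation Im := complex.Im.

(** * Unordered sums of complex numbers *)

Section NormC.
Variable R : realType.
Implicit Types x y z : R[i].

(** [H] is an arbitrary Hilbert space of functions reproducing the kernel: neither a basis nor the
    membership of a single monomial is given. Functions are therefore placed in [H] by duality, from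
    a bound on their pairings with finite kernel combinations; completeness enters only there. This
    criterion yields the polynomials, and also the multipliers, since the adjoint of a
    multiplication acts diagonally on kernel functions.

    Orthogonality between degrees is replaced by uniqueness of expansions: a function vanishing at
    the origin to order more than [n] has no coefficient of degree at most [n]. As [J] may be
    infinite, the order of vanishing is measured along real curves in finitely many coordinates.

    The constant 1/3 is the ratio whose geometric series, started at degree 1, sums to 1/2. On the
    other side, with [r = |z|], the majorant of the test function at [z] is
    [a + (1 - a ^ 2) * r / (1 - a * r)], which exceeds 1 exactly when [r * (1 + 2 * a) > 1]; letting
    [a] tend to 1 gives the same threshold. *)

Lemma normCE z : `|z| = (normc z)%:C.
Proof. by case: z. Qed.

Lemma normc_ge0 z : 0 <= normc z.
Proof. by case: z => a b; rewrite sqrtr_ge0. Qed.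

Lemma normcB x y : normc (x - y) = normc (y - x).
Proof. by rewrite -normcN opprB. Qed.

Lemma normc_real (r : R) : normc r%:C = `|r|.
Proof. by rewrite /= expr0n addr0 sqrtr_sqr. Qed.

Lemma normc_conj z : normc (conjc z) = normc z.
Proof. by case: z => a b /=; rewrite sqrrN. Qed.

Lemma mulcJ z : z * conjc z = (normc z ^+ 2)%:C.
Proof. by rewrite -sqr_normc normCE rmorphXn. Qed.

Lemma normc_eq0 z : (normc z == 0) = (z == 0).
Proof. by apply/eqP/eqP => [/eq0_normc//|->]; rewrite normc0. Qed.

Lemma Re_le_normc z : Re z <= normc z.
Proof.
apply: le_trans (ler_norm _) _.
by rewrite -lecR -normCE; exact: normc_ge_Re.
Qed.

Lemma le_normc_sum (I : Type) (r : seq I) (P : pred I) (F : I -> R[i]) :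
  normc (\sum_(i <- r | P i) F i) <= \sum_(i <- r | P i) normc (F i).
Proof.
elim/big_ind2 : _ => [|x a y b xa yb|//]; first by rewrite normc0.
by apply: le_trans (le_normcD _ _) _; exact: lerD.
Qed.

Lemma normc_prod (I : Type) (r : seq I) (P : pred I) (F : I -> R[i]) :
  normc (\prod_(i <- r | P i) F i) = \prod_(i <- r | P i) normc (F i).
Proof. exact: (big_morph _ (@normcM R) (@normc1 R)). Qed.

Lemma normcX z n : normc (z ^+ n) = normc z ^+ n.
Proof. by elim: n => [|n IH]; rewrite ?expr0 ?normc1// !exprS normcM IH. Qed.

Lemma normc_tri x y z : normc (x - z) <= normc (x - y) + normc (y - z).
Proof. by apply: le_trans (le_normcD _ _); rewrite addrA subrK. Qed.

Lemma ReD x y : Re (x + y) = Re x + Re y. Proof. by case: x; case: y. Qed.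
Lemma ReN x : Re (- x) = - Re x. Proof. by case: x. Qed.
Lemma Re_sum (I : Type) (r : seq I) (P : pred I) (F : I -> R[i]) :
  Re (\sum_(i <- r | P i) F i) = \sum_(i <- r | P i) Re (F i).
Proof. by elim/big_ind2 : _ => // x a y b; rewrite ReD => -> ->. Qed.
Lemma realcM (a b : R) : (a * b)%:C = a%:C * b%:C. Proof. exact: rmorphM. Qed.
Lemma realcB (a b : R) : (a - b)%:C = a%:C - b%:C. Proof. exact: rmorphB. Qed.
Lemma realcX (a : R) n : (a ^+ n)%:C = a%:C ^+ n. Proof. exact: rmorphXn. Qed.
Lemma realc_nat n : (n%:R : R)%:C = n%:R. Proof. exact: rmorph_nat. Qed.
Lemma realc_sum (I : Type) (r : seq I) (P : pred I) (F : I -> R) :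
  (\sum_(i <- r | P i) F i)%:C = \sum_(i <- r | P i) (F i)%:C.
Proof. exact: rmorph_sum. Qed.
Lemma conjcM x y : conjc (x * y) = conjc x * conjc y. Proof. exact: rmorphM. Qed.
Lemma conjcB x y : conjc (x - y) = conjc x - conjc y. Proof. exact: rmorphB. Qed.
Lemma conjc_sum (I : Type) (r : seq I) (P : pred I) (F : I -> R[i]) :
  conjc (\sum_(i <- r | P i) F i) = \sum_(i <- r | P i) conjc (F i).
Proof. exact: rmorph_sum. Qed.

End NormC.

(** * Convergence along finite subsets *)

Section HasCsum.
Variables (R : realType) (I : choiceType).
Implicit Types (f g : I -> R[i]) (s t : R[i]) (A : {fset I}).

Lemma fset_sum_le (f : I -> R) A B : (forall i, 0 <= f i) ->
  (A `<=` B)%fset -> \sum_(i <- A) f i <= \sum_(i <- B) f i.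
Proof.
move=> f0 /fsubsetP AB.
rewrite [leRHS](big_fsetID _ (mem A)) /= ler_wpDr ?sumr_ge0//.
rewrite le_eqVlt; apply/orP; left; apply/eqP; apply: eq_fbigl => i.
by rewrite !inE /=; apply/idP/andP => [iA|[]//]; split => //; exact: AB.
Qed.

(** [csum] is a limit operator, hence total and uninformative on divergent families; this relation
    carries the convergence itself, and [has_csum_csum] returns to [csum]. *)
Definition has_csum f s := forall e : R, 0 < e ->
  exists A0 : {fset I}, forall A, (A0 `<=` A)%fset ->
    normc (\sum_(i <- A) f i - s) < e.

Definition abs_bounded f (B : R) := forall A, \sum_(i <- A) normc (f i) <= B.

Lemma has_csum_csum f s : has_csum f s -> csum f = s.
Proof.
move=> fs; rewrite /csum /summability.sum.
apply: (@cvg_lim (R[i]^o : normedModType R[i])); first exact: norm_hausdorff.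
  exact: summability.totally_filter.
have := @summability.totally_filter I => totF.
apply/(@cvgrPdist_lt _ (R[i]^o : normedModType R[i])) => /= e e0.
have e0' : 0 < Re e by move: e0; rewrite ltcE /= => /andP[_].
have eE : e = (Re e)%:C by rewrite RRe_real// gtr0_real.
have [A0 HA0] := fs _ e0'.
exists A0 => // A /= A0A.
have -> : summability.partial_sum (f : I -> R[i]^o) A = \sum_(i <- A) f i.
  by rewrite [RHS]big_seq_fsetE.
rewrite [X in X < _](normCE (s - \sum_(i <- A) f i)) eE ltcR normcB; exact: HA0.
Qed.

Lemma eq_has_csum f g : f =1 g -> forall s, has_csum f s -> has_csum g s.
Proof. by move=> /funext ->. Qed.

Lemma has_csum_unique f s t : has_csum f s -> has_csum f t -> s = t.
Proof. by move=> /has_csum_csum <- /has_csum_csum <-. Qed.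

Lemma has_csumD f g s t : has_csum f s -> has_csum g t ->
  has_csum (fun i => f i + g i) (s + t).
Proof.
move=> fs gt e e0.
have e20 : 0 < e / 2 by rewrite divr_gt0.
have [A HA] := fs _ e20; have [B HB] := gt _ e20.
exists (A `|` B)%fset => D; rewrite fsubUset => /andP[AD BD].
rewrite big_split /= opprD addrACA (splitr e).
by apply: le_lt_trans (le_normcD _ _) _; apply: ltrD; [exact: HA|exact: HB].
Qed.

Lemma has_csumZ c f s : has_csum f s -> has_csum (fun i => c * f i) (c * s).
Proof.
move=> fs e e0.
have c0 : 0 < normc c + 1 by rewrite ltr_wpDl ?normc_ge0.
have ec0 : 0 < e / (normc c + 1) by rewrite divr_gt0.
have [A HA] := fs _ ec0.
exists A => D AD.
rewrite -mulr_sumr -mulrBr normcM.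
apply: (@le_lt_trans _ _ ((normc c + 1) * normc (\sum_(i <- D) f i - s))).
  by rewrite ler_wpM2r ?normc_ge0// lerDl.
by rewrite mulrC -ltr_pdivlMr//; exact: HA.
Qed.

Lemma has_csum0 : has_csum (fun=> 0) 0.
Proof. by move=> e e0; exists fset0 => A _; rewrite big1// subrr normc0. Qed.

Lemma has_csum_sum (J : Type) (r : seq J) (f : J -> I -> R[i]) (s : J -> R[i]) :
  (forall j, has_csum (f j) (s j)) ->
  has_csum (fun i => \sum_(j <- r) f j i) (\sum_(j <- r) s j).
Proof.
move=> fs; elim: r => [|j r IH].
  rewrite big_nil; apply: eq_has_csum has_csum0 => i; by rewrite big_nil.
rewrite big_cons.
by apply: eq_has_csum (has_csumD (fs j) IH) => i; rewrite big_cons.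
Qed.

Lemma has_csum_conj f s : has_csum f s ->
  has_csum (fun i => conjc (f i)) (conjc s).
Proof.
move=> fs e e0; have [A HA] := fs _ e0; exists A => D AD.
by rewrite -rmorph_sum -rmorphB normc_conj; exact: HA.
Qed.

Lemma has_csum_le f s A1 (b : R) (c : R[i]) : has_csum f s ->
  (forall A, (A1 `<=` A)%fset -> normc (\sum_(i <- A) f i - c) <= b) ->
  normc (s - c) <= b.
Proof.
move=> fs fb; apply/ler_addgt0Pr => e e0.
have [A HA] := fs _ e0.
have := HA (A `|` A1)%fset (fsubsetUl _ _).
have := fb (A `|` A1)%fset (fsubsetUr _ _).
set S := \sum_(i <- _) _ => H1 H2.
apply: le_trans (normc_tri _ S _) _; rewrite addrC lerD// normcB.
exact: ltW.
Qed.

Lemma has_csum_norm_le f s (b : R) : has_csum f s ->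
  abs_bounded f b -> normc s <= b.
Proof.
move=> fs fb; rewrite -[s]subr0; apply: (has_csum_le (A1 := fset0) fs) => A _.
by rewrite subr0; apply: le_trans (le_normc_sum _ _ _) _; exact: fb.
Qed.

Lemma has_csum_Re_ge f s A1 (b : R) : has_csum f s ->
  (forall A, (A1 `<=` A)%fset -> b <= Re (\sum_(i <- A) f i)) -> b <= Re s.
Proof.
move=> fs fb; apply/ler_addgt0Pr => e e0.
have [A HA] := fs _ e0.
have := HA (A `|` A1)%fset (fsubsetUl _ _).
have := fb (A `|` A1)%fset (fsubsetUr _ _).
set S := \sum_(i <- _) _ => H1 H2.
apply: le_trans H1 _; rewrite addrC -lerBlDr -ReN -ReD.
by apply: le_trans (Re_le_normc _) _; exact: ltW.
Qed.

Lemma has_csum_ge_partial (f : I -> R) (s : R) A : (forall i, 0 <= f i) ->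
  has_csum (fun i => (f i)%:C) s%:C -> \sum_(i <- A) f i <= s.
Proof.
move=> f0 fs; apply: (has_csum_Re_ge (A1 := A) fs) => B AB.
by rewrite Re_sum; exact: fset_sum_le.
Qed.

Lemma has_csum_nneg (f : I -> R) (B : R) : (forall i, 0 <= f i) ->
  (forall A, \sum_(i <- A) f i <= B) ->
  exists s : R, has_csum (fun i => (f i)%:C) s%:C.
Proof.
move=> f0 fB.
pose E := [set \sum_(i <- A) f i | A in [set: {fset I}]].
have hE : has_sup E.
  split; first by exists (\sum_(i <- (fset0 : {fset I})) f i); exists fset0.
  by exists B => _ [A _ <-].
exists (sup E) => e e0.
have [_ [A _ <-] HA] := sup_adherent e0 hE.
exists A => D AD; rewrite -rmorph_sum -rmorphB normc_real.
have D1 : \sum_(i <- D) f i <= sup E by apply: ub_le_sup; [exact: hE.2|exists D].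
have D2 : \sum_(i <- A) f i <= \sum_(i <- D) f i.
  exact: fset_sum_le.
by rewrite distrC ger0_norm ?subr_ge0//; lra.
Qed.

(** [f] is the difference of the nonnegative families [|f|] and [|f| - f], whose partial sums are
    bounded by [B] and [B + B]. *)
Lemma has_csum_real (f : I -> R) (B : R) :
  (forall A, \sum_(i <- A) `|f i| <= B) ->
  exists s : R, has_csum (fun i => (f i)%:C) s%:C.
Proof.
move=> fB.
have [s1 H1] := @has_csum_nneg (fun i => `|f i|) B (fun i => normr_ge0 _) fB.
have [] := @has_csum_nneg (fun i => `|f i| - f i) (B + B).
- by move=> i; rewrite subr_ge0 ler_norm.
- move=> A; rewrite big_split /= lerD//.
  apply: le_trans (fB A); apply: ler_sum => i _.
  by rewrite -[leRHS]normrN ler_norm.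
move=> s2 H2; exists (s1 - s2).
rewrite rmorphB /= -mulN1r.
apply: eq_has_csum (has_csumD H1 (has_csumZ (-1) H2)) => i.
by rewrite mulN1r -rmorphN -rmorphD /= opprB addrCA subrr addr0.
Qed.

Lemma abs_bounded_has_csum f B : abs_bounded f B -> has_csum f (csum f).
Proof.
move=> fB.
suff [s fs] : exists s, has_csum f s by rewrite (has_csum_csum fs).
have [|a Ha] := @has_csum_real (fun i => Re (f i)) B.
  move=> A; apply: le_trans (fB A); apply: ler_sum => i _ /=.
  by rewrite -lecR -normCE; exact: normc_ge_Re.
have [|b Hb] := @has_csum_real (fun i => Im (f i)) B.
  move=> A; apply: le_trans (fB A); apply: ler_sum => i _ /=.
  rewrite -sqrtr_sqr; case: (f i) => x y /=; apply: ler_wsqrtr.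
  by rewrite lerDr sqr_ge0.
exists (a%:C + 'i * b%:C).
apply: eq_has_csum (has_csumD Ha (has_csumZ 'i Hb)) => i /=.
by rewrite [RHS]complexE.
Qed.

(** The bridge from the extended-valued sums in [l2sum], [majorant] and [summable] to bounds on
    finite partial sums. *)
Lemma esum_EFin_le (f : I -> R) (B : R) :
  (\esum_(i in [set: I]) (f i)%:E <= B%:E)%E <->
  (forall A, \sum_(i <- A) f i <= B).
Proof.
have fsE A : (\sum_(i \in [set` A]) (f i)%:E = (\sum_(i <- A) f i)%:E)%E.
  rewrite -sumEFin fsbig_finite//=; apply: perm_big; apply: uniq_perm => //.
  by move=> x; rewrite in_fset_set//; apply/idP/idP; rewrite ?inE//=.
split=> [fB A|fB].
  rewrite -lee_fin -fsE; apply: le_trans fB.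
  by apply: esum_ge; exists [set` A] => //; split.
apply: ge_ereal_sup => _ [X [finX _] <-].
have [A ->] : exists A : {fset I}, X = [set` A].
  by exists (fset_set X); rewrite fset_setK.
by rewrite fsE lee_fin.
Qed.

Lemma abs_bounded_summable f B : abs_bounded f B ->
  summable [set: I] (fun i => (normc (f i))%:E).
Proof.
move=> /esum_EFin_le fB; rewrite /summable.
under eq_esum do rewrite gee0_abs ?lee_fin ?normc_ge0//.
exact: le_lt_trans fB (ltry _).
Qed.

Lemma summable_abs_bounded f :
  summable [set: I] (fun i => (normc (f i))%:E) -> exists B, abs_bounded f B.
Proof.
rewrite /summable.
under eq_esum do rewrite gee0_abs ?lee_fin ?normc_ge0//.
move=> foo; exists (fine (\esum_(i in [set: I]) (normc (f i))%:E)).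
apply/esum_EFin_le; rewrite fineK//.
by rewrite ge0_fin_numE// esum_ge0// => i _; rewrite lee_fin normc_ge0.
Qed.

End HasCsum.

(** * Multi-indices and the multinomial theorem *)

Section MultiIndex.
Variable J : choiceType.
Local Notation multi_index := {fsfun J -> nat with 0%N}.
Implicit Types (g h : multi_index) (w : seq J) (S : {fset J}).

Definition deg g : nat := \sum_(j <- finsupp g) g j.

(** A representative of the words with letter multiplicities [g]. Passing from multi-indices to
    words reduces the multinomial theorem to distributivity. *)
Definition word g : seq J := flatten [seq nseq (g j) j | j <- finsupp g].

(** The multinomial coefficient [deg g! / g!], as a number of words. *)
Definition mult g : nat := size (permutations (word g)).

Definition content w : multi_index :=
  [fsfun j in seq_fset tt w => count_mem j w].

Lemma count_word g j : count_mem j (word g) = g j.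
Proof.
rewrite /word count_flatten -map_comp sumnE big_map.
under eq_bigr do rewrite /= count_nseq /=.
have [jg|jg] := boolP (j \in finsupp g); last first.
  rewrite (fsfun_dflt jg) big_seq big1// => i ig.
  by case: eqP => [ij|//]; rewrite -ij ig in jg.
rewrite (big_fsetD1 j)//= eqxx mul1n big1_seq ?addn0// => i /=.
by rewrite !inE => /andP[/negPf ->].
Qed.

Lemma contentE w j : content w j = count_mem j w.
Proof.
rewrite fsfun_fun seq_fsetE; case: ifPn => // jw.
by apply/esym/count_memPn.
Qed.

Lemma perm_word w g : perm_eq w (word g) = (content w == g).
Proof.
apply/idP/eqP => [/permP wg|<-].
  by apply/fsfunP => j; rewrite contentE wg count_word.
by apply/allP => j _ /=; rewrite count_word contentE.
Qed.

Lemma mult_gt0 g : (0 < mult g)%N.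
Proof.
have : word g \in permutations (word g) by rewrite mem_permutations.
by rewrite /mult; case: permutations.
Qed.

Lemma size_word g : size (word g) = deg g.
Proof.
rewrite /word size_flatten sumnE /shape -map_comp big_map.
by apply: eq_bigr => j _ /=; rewrite size_nseq.
Qed.

Lemma mem_word g j : (j \in word g) = (j \in finsupp g).
Proof. by rewrite -has_pred1 has_count count_word mem_finsupp lt0n. Qed.

Lemma deg_content w : deg (content w) = size w.
Proof.
rewrite -size_word; apply/esym/perm_size.
by rewrite perm_word.
Qed.

Lemma finsupp_content w j : (j \in finsupp (content w)) = (j \in w).
Proof. by rewrite mem_finsupp contentE -lt0n -has_count has_pred1. Qed.

Fixpoint words (n : nat) (s : seq J) : seq (seq J) :=
  if n is n'.+1 then [seq j :: w | j <- s, w <- words n' s] else [:: [::]].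

Lemma mem_words n s w :
  (w \in words n s) = (size w == n) && all (mem s) w.
Proof.
elim: n w => [|n IH] [|j w] //=.
  by apply/negbTE/allpairsP => -[[? ?] []].
apply/allpairsP/idP => [[[i v] [/= si vs [-> ->]]]|].
  by move: vs; rewrite IH si /= => /andP[/eqP -> ->]; rewrite eqxx.
rewrite eqSS => /and3P[/eqP wn js ws]; exists (j, w); split => //=.
by rewrite IH wn eqxx.
Qed.

Lemma words_uniq n s : uniq s -> uniq (words n s).
Proof.
move=> us; elim: n => [//|n IH] /=; apply: allpairs_uniq => //.
by move=> [a b] [c d] _ _ [-> ->].
Qed.

Definition layer S (n : nat) : {fset multi_index} :=
  [fset content w | w in seq_fset tt (words n S)]%fset.

Lemma mem_layer S n g :
  (g \in layer S n) = (deg g == n) && (finsupp g `<=` S)%fset.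
Proof.
apply/imfsetP/idP => [[w]|/andP[/eqP dg /fsubsetP gS]].
  rewrite seq_fsetE mem_words => /andP[/eqP wn /allP wS] ->.
  rewrite deg_content wn eqxx /=; apply/fsubsetP => j.
  by rewrite finsupp_content => /wS.
exists (word g); last by apply/esym/eqP; rewrite -perm_word.
rewrite seq_fsetE mem_words size_word dg eqxx /=.
by apply/allP => j; rewrite mem_word => /gS.
Qed.

(** These sets are cofinal among finite sets of multi-indices ([sub_box]), and sums over them split
    by degree ([sum_box]). *)
Definition box S (n : nat) : {fset multi_index} :=
  \big[fsetU/fset0]_(k < n.+1) layer S k.

Lemma mem_box S n g :
  (g \in box S n) = (deg g <= n)%N && (finsupp g `<=` S)%fset.
Proof.
rewrite /box; elim: n => [|n IH].
  by rewrite big_ord_recr big_ord0 /= fset0U mem_layer leqn0.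
rewrite big_ord_recr /= inE IH mem_layer -andb_orl; congr (_ && _).
by rewrite [RHS]leq_eqVlt orbC ltnS.
Qed.

Lemma sub_box (A : {fset multi_index}) : exists S n, (A `<=` box S n)%fset.
Proof.
exists (\bigcup_(g <- A) finsupp g)%fset, (\max_(g <- A) deg g)%N.
apply/fsubsetP => g gA; rewrite mem_box; apply/andP; split.
  by rewrite (big_fsetD1 g)//= leq_maxl.
by rewrite (big_fsetD1 g)//= fsubsetUl.
Qed.

Lemma box_mono S S' n n' : (S `<=` S')%fset -> (n <= n')%N ->
  (box S n `<=` box S' n')%fset.
Proof.
move=> SS nn; apply/fsubsetP => g; rewrite !mem_box => /andP[gn gS].
by rewrite (leq_trans gn nn) (fsubset_trans gS SS).
Qed.

Section Ring.
Variable K : comNzRingType.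
Implicit Types x y : J -> K.

Definition mon x g : K := \prod_(j <- finsupp g) x j ^+ g j.

Lemma mon_word x g : mon x g = \prod_(j <- word g) x j.
Proof.
rewrite /word big_flatten big_map; apply: eq_bigr => j _.
by elim: (g j) => [|m IH]; rewrite /= ?big_nil ?expr0// big_cons exprS IH.
Qed.

Lemma mon_content x w : mon x (content w) = \prod_(j <- w) x j.
Proof. by rewrite mon_word; apply/esym/perm_big; rewrite perm_word. Qed.

Lemma monM x y g : mon (fun j => x j * y j) g = mon x g * mon y g.
Proof. by rewrite /mon -big_split /=; apply: eq_bigr => j _; rewrite exprMn. Qed.

Lemma mon_scale c x g : mon (fun j => c * x j) g = c ^+ deg g * mon x g.
Proof. by rewrite monM; congr (_ * _); rewrite /mon /deg -prodrXr. Qed.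

Lemma mon_eq0 x g j : j \in finsupp g -> x j = 0 -> mon x g = 0.
Proof.
move=> jg xj; rewrite /mon (big_fsetD1 j)//= xj expr0n.
by move: jg; rewrite mem_finsupp => /negPf ->; rewrite mul0r.
Qed.

Lemma eq_mon x y g : {in finsupp g, x =1 y} -> mon x g = mon y g.
Proof. by move=> xy; rewrite /mon; apply: eq_big_seq => j /xy ->. Qed.

Lemma sum_words x n s :
  \sum_(w <- words n s) \prod_(j <- w) x j = (\sum_(j <- s) x j) ^+ n.
Proof.
elim: n => [|n IH] /=; first by rewrite big_seq1 big_nil expr0.
rewrite big_allpairs_dep exprS mulr_suml; apply: eq_bigr => j _.
by rewrite -IH mulr_sumr; apply: eq_bigr => w _; rewrite big_cons.
Qed.

(** Expand the power over words of length [n] and group them by content: the fibre over [g] consists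
    of the permutations of [word g], all with the same monomial. *)
Lemma multinomial x n S :
  \sum_(g <- layer S n) (mult g)%:R * mon x g = (\sum_(j <- S) x j) ^+ n.
Proof.
rewrite -sum_words.
have uw := words_uniq n (fset_uniq S).
have pw : perm_eq (seq_fset tt (words n S)) (words n S).
  by apply: uniq_perm => // w; rewrite seq_fsetE.
rewrite -(perm_big _ pw).
rewrite (partition_big_imfset _ content) -/(layer S n).
apply: eq_big_seq => g; rewrite mem_layer => /andP[/eqP gn /fsubsetP gS].
rewrite (eq_bigr (fun=> mon x g)); last by move=> w /eqP <-; rewrite mon_content.
rewrite (perm_big _ pw) /= big_const_seq -Monoid.iteropE /=.
rewrite mulr_natl; congr (_ *+ _).
rewrite -size_filter; apply/perm_size/uniq_perm.
- exact: permutations_uniq.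
- exact: filter_uniq.
move=> w; rewrite mem_permutations mem_filter perm_word mem_words.
case: eqP => //= wg; apply/esym/andP; split.
  by rewrite -deg_content wg gn.
apply/allP => j jw /=; apply: gS.
by rewrite -wg finsupp_content.
Qed.

Lemma sum_box (F : multi_index -> K) n S :
  \sum_(g <- box S n) F g = \sum_(k < n.+1) \sum_(g <- layer S k) F g.
Proof.
elim: n => [|n IH].
  by rewrite /box !big_ord_recr !big_ord0 /= add0r fset0U.
rewrite big_ord_recr /= -IH (big_fsetID _ (fun g => deg g <= n)%N) /=.
by congr (_ + _); apply: eq_fbigl => g;
  rewrite !inE /= ?mem_box ?mem_layer; lia.
Qed.

End Ring.

Lemma normc_mon (R : realType) (x : J -> R[i]) g :
  normc (mon x g) = mon (fun j => normc (x j)) g.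
Proof. by rewrite /mon normc_prod; apply: eq_bigr => j _; rewrite normcX. Qed.

Lemma mon_ge0 (R : realType) (x : J -> R) g : (forall j, 0 <= x j) -> 0 <= mon x g.
Proof. by move=> x0; apply: prodr_ge0 => j _; exact: exprn_ge0. Qed.

End MultiIndex.

(** * Expansion of the kernel *)

Section Kernel.
Variables (R : realType) (J : choiceType).
Local Notation multi_index := {fsfun J -> nat with 0%N}.
Implicit Types (z w : J -> R[i]) (S : {fset J}).

Lemma geometric_sum (K : comNzRingType) (t : K) n :
  (1 - t) * \sum_(k < n) t ^+ k = 1 - t ^+ n.
Proof. by rewrite -opprB mulNr -subrX1 opprB. Qed.

Lemma geometric_sum_le (r : R) n : 0 <= r -> r < 1 ->
  \sum_(k < n) r ^+ k <= (1 - r)^-1.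
Proof.
move=> r0 r1; rewrite -[leRHS]mul1r ler_pdivlMr ?subr_gt0// mulrC.
by rewrite geometric_sum gerBl exprn_ge0.
Qed.

Lemma sum_layer_le (x : J -> R) (r : R) n (A : {fset multi_index}) :
  (forall j, 0 <= x j) -> (forall S, \sum_(j <- S) x j <= r) ->
  (forall g, g \in A -> deg g = n) ->
  \sum_(g <- A) (mult g)%:R * mon x g <= r ^+ n.
Proof.
move=> x0 xr An.
have [S [m /fsubsetP AS]] := sub_box A.
have r0 : 0 <= r by apply: le_trans (xr fset0); rewrite big_seq_fset0.
have m0 g : 0 <= (mult g)%:R * mon x g by rewrite mulr_ge0 ?ler0n ?mon_ge0.
apply: (@le_trans _ _ (\sum_(g <- layer S n) (mult g)%:R * mon x g)); last first.
  by rewrite multinomial; apply: lerXn2r; rewrite ?nnegrE ?sumr_ge0.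
apply: fset_sum_le => //; apply/fsubsetP => g gA; rewrite mem_layer An// eqxx.
by move: (AS _ gA); rewrite mem_box => /andP[].
Qed.

Lemma mult_mon_le (x : J -> R) (r : R) (A : {fset multi_index}) :
  (forall j, 0 <= x j) -> (forall S, \sum_(j <- S) x j <= r) -> r < 1 ->
  \sum_(g <- A) (mult g)%:R * mon x g <= (1 - r)^-1.
Proof.
move=> x0 xr r1.
have [S [n AS]] := sub_box A.
have r0 : 0 <= r by apply: le_trans (xr fset0); rewrite big_seq_fset0.
have m0 g : 0 <= (mult g)%:R * mon x g by rewrite mulr_ge0 ?ler0n ?mon_ge0.
apply: (@le_trans _ _ (\sum_(g <- box S n) (mult g)%:R * mon x g)).
  exact: fset_sum_le.
rewrite sum_box; apply: le_trans (geometric_sum_le n.+1 r0 r1).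
apply: ler_sum => k _; rewrite multinomial.
by apply: lerXn2r; rewrite ?nnegrE ?sumr_ge0.
Qed.

Lemma abs_bounded_mult_mon (x : J -> R[i]) (r : R) :
  abs_bounded x r -> r < 1 ->
  abs_bounded (fun g : multi_index => (mult g)%:R * mon x g) (1 - r)^-1.
Proof.
move=> xr r1 A; apply: le_trans (mult_mon_le A _ xr r1).
  apply: ler_sum => g _; rewrite normcM normc_mon ler_wpM2r//.
    by rewrite mon_ge0// => j; exact: normc_ge0.
  by rewrite -(rmorph_nat (real_complex R)) normc_real ger0_norm.
by move=> j; exact: normc_ge0.
Qed.

(** The sum [s] exists by absolute convergence. Over a box, the partial sum [Y] is an exact finite
    geometric sum in the partial sum [tau] of [x], and the relation [(1 - tau) * Y = 1 - tau ^ m.+1]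
    passes to the limit. *)
Lemma has_csum_geometric (x : J -> R[i]) (r : R) (t : R[i]) :
  abs_bounded x r -> r < 1 -> has_csum x t ->
  has_csum (fun g : multi_index => (mult g)%:R * mon x g) (1 - t)^-1.
Proof.
move=> xr r1 xt.
have r0 : 0 <= r by apply: le_trans (xr fset0); rewrite big_seq_fset0.
have tr : normc t <= r by exact: has_csum_norm_le xt xr.
have t1 : 1 - t != 0.
  rewrite subr_eq0; apply: contraTneq tr => <-.
  by rewrite normc1 -ltNge.
have bd := abs_bounded_mult_mon xr r1.
have := abs_bounded_has_csum bd; set s := csum _ => fs.
suff sE : (1 - t) * s = 1.
  by have -> : (1 - t)^-1 = s by rewrite -[s](mulKf t1) sE mulr1.
apply/eqP; rewrite -subr_eq0 -normc_eq0 eq_le normc_ge0 andbT.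
have b0 : 0 <= (1 - r)^-1 by rewrite invr_ge0 subr_ge0 ltW.
apply/ler_addgt0Pr => e e0; rewrite add0r.
have nt0 : 0 < normc (1 - t) by rewrite lt_neqAle normc_ge0 eq_sym normc_eq0 t1.
have e1 : 0 < e / 3 / normc (1 - t) by rewrite !divr_gt0.
have [A HA] := fs _ e1.
have b1 : 0 < (1 - r)^-1 + 1 by rewrite ltr_wpDl.
have e2 : 0 < e / 3 / ((1 - r)^-1 + 1) by rewrite !divr_gt0.
have [T HT] := xt _ e2.
have [S [n An]] := sub_box A.
have [m Hm] : exists m, (n <= m)%N /\ r ^+ m.+1 <= e / 3.
  have e3 : 0 < e / 3 by rewrite divr_gt0.
  have : (fun n : nat => r ^+ n) @ \oo --> (0 : R).
    by apply: cvg_expr; rewrite ger0_norm.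
  move=> /cvgrPdist_le /(_ _ e3)[N _ HN].
  exists (maxn n N); split; first exact: leq_maxl.
  have /HN : (N <= (maxn n N).+1)%N by rewrite leqW// leq_maxr.
  by rewrite /= sub0r normrN ger0_norm// exprn_ge0.
have [nm rm] := Hm.
set U := (S `|` T)%fset.
have AU : (A `<=` box U m)%fset.
  by apply: fsubset_trans An _; apply: box_mono => //; exact: fsubsetUl.
have {HA} := HA _ AU; set Y := \sum_(i <- _) _ => HY.
have {HT} := HT U (fsubsetUr _ _); set tau := \sum_(i <- _) _ => Htau.
have YE : (1 - tau) * Y = 1 - tau ^+ m.+1.
  rewrite -geometric_sum; congr (_ * _); rewrite /Y sum_box.
  by apply: eq_bigr => k _; rewrite multinomial.
have Yb : normc Y <= (1 - r)^-1.
  by apply: le_trans (le_normc_sum _ _ _) _; exact: bd.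
have taur : normc tau <= r.
  by apply: le_trans (le_normc_sum _ _ _) _; exact: xr.
(* Three errors of at most [e / 3] each: the box against the whole sum, [tau] against [t], and the
   truncation of the geometric series. *)
have -> : (1 - t) * s - 1 = (1 - t) * (s - Y) + ((tau - t) * Y - tau ^+ m.+1).
  have -> : tau ^+ m.+1 = 1 - (1 - tau) * Y by rewrite YE opprB addrC subrK.
  by ring.
apply: le_trans (le_normcD _ _) _.
rewrite (_ : e = e / 3 + (e / 3 + e / 3)); last by field.
apply: lerD.
  by rewrite normcM mulrC -ler_pdivlMr// normcB ltW.
apply: le_trans (le_normcD _ _) _; apply: lerD.
  rewrite normcM.
  apply: (@le_trans _ _ (normc (tau - t) * ((1 - r)^-1 + 1))).
    by rewrite ler_wpM2l ?normc_ge0// (le_trans Yb)// lerDl.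
  by rewrite -ler_pdivlMr// ltW.
rewrite normcN normcX; apply: le_trans rm.
by apply: lerXn2r; rewrite ?nnegrE ?normc_ge0.
Qed.

(** * Square-summable vectors and the kernel on the ball *)

Lemma l2norm_sq z : (l2sum z < +oo)%E -> l2norm z ^+ 2 = fine (l2sum z).
Proof.
move=> zoo; rewrite sqr_sqrtr// fine_ge0// esum_ge0// => j _.
by rewrite lee_fin sqr_ge0.
Qed.

Lemma l2sum_fin z : (l2sum z < +oo)%E -> l2sum z = (l2norm z ^+ 2)%:E.
Proof.
move=> zoo; rewrite l2norm_sq// fineK// ge0_fin_numE// esum_ge0// => j _.
by rewrite lee_fin sqr_ge0.
Qed.

Lemma sum_sq_le z S : (l2sum z < +oo)%E ->
  \sum_(j <- S) normc (z j) ^+ 2 <= l2norm z ^+ 2.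
Proof.
move=> zoo; have := l2sum_fin zoo; rewrite /l2sum => zE.
by move: S; apply/esum_EFin_le; rewrite zE.
Qed.

Lemma sum_sq_l2norm z (B : R) : 0 <= B ->
  (forall S, \sum_(j <- S) normc (z j) ^+ 2 <= B ^+ 2) ->
  (l2sum z < +oo)%E /\ l2norm z <= B.
Proof.
move=> B0 /esum_EFin_le zB.
have zoo : (l2sum z < +oo)%E by apply: le_lt_trans zB (ltry _).
split=> //; move: zB; rewrite -/(l2sum z) (l2sum_fin zoo) lee_fin.
by rewrite ler_pXn2r// ?nnegrE// /l2norm sqrtr_ge0.
Qed.

(** The inequality of arithmetic and geometric means, term by term. On the ball the bound is already
    less than 1 ([ball_sum_lt1]), as the geometric series requires. *)
Lemma inner_abs_bounded z w : (l2sum z < +oo)%E -> (l2sum w < +oo)%E ->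
  abs_bounded (fun j => z j * conjc (w j))
    ((l2norm z ^+ 2 + l2norm w ^+ 2) / 2).
Proof.
move=> zoo woo S.
apply: (@le_trans _ _ (\sum_(j <- S)
    (normc (z j) ^+ 2 + normc (w j) ^+ 2) / 2)).
  apply: ler_sum => j _; rewrite normcM normc_conj.
  have := sqr_ge0 (normc (z j) - normc (w j)).
  by rewrite sqrrB; lra.
rewrite -mulr_suml ler_pM2r ?invr_gt0// big_split /=.
by rewrite lerD// sum_sq_le.
Qed.

Lemma has_csum_inner z w : (l2sum z < +oo)%E -> (l2sum w < +oo)%E ->
  has_csum (fun j => z j * conjc (w j)) (inner z w).
Proof.
by move=> zoo woo; apply: abs_bounded_has_csum; exact: inner_abs_bounded.
Qed.

Lemma ball_sum_lt1 (z w : l2ball R J) :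
  (l2norm (val z) ^+ 2 + l2norm (val w) ^+ 2) / 2 < 1.
Proof.
have lt1 (x : l2ball R J) : l2norm (val x) ^+ 2 < 1.
  have [_ x1] := set_mem (valP x); rewrite expr_lt1//; exact: sqrtr_ge0.
by have := lt1 z; have := lt1 w; lra.
Qed.

Lemma ball_fin (z : l2ball R J) : (l2sum (val z) < +oo)%E.
Proof. by have [] := set_mem (valP z). Qed.

Lemma mon_conj z (g : multi_index) : mon (fun j => conjc (z j)) g = conjc (mon z g).
Proof. by rewrite /mon rmorph_prod; apply: eq_bigr => j _; rewrite rmorphXn. Qed.

Lemma has_csum_kernel (z w : l2ball R J) :
  has_csum (fun g => (mult g)%:R * (mon (val z) g * conjc (mon (val w) g)))
    (da_kernel R J z w).
Proof.
rewrite /da_kernel div1r.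
have bd := inner_abs_bounded (ball_fin z) (ball_fin w).
have := has_csum_geometric bd (ball_sum_lt1 z w)
  (has_csum_inner (ball_fin z) (ball_fin w)).
by apply: eq_has_csum => g; rewrite monM mon_conj.
Qed.

Lemma inner_lt1 (z w : l2ball R J) : normc (inner (val z) (val w)) < 1.
Proof.
apply: le_lt_trans (ball_sum_lt1 z w).
apply: has_csum_norm_le (inner_abs_bounded _ _); try exact: ball_fin.
by apply: has_csum_inner; exact: ball_fin.
Qed.

End Kernel.

(** * Uniqueness of monomial expansions *)

Section Vanishing.
Variables (R : realType) (J : choiceType).
Local Notation multi_index := {fsfun J -> nat with 0%N}.
Implicit Types (g h : multi_index) (S : {fset J}).

Lemma le_deg g j : (g j <= deg g)%N.
Proof.
have [jg|/fsfun_dflt ->//] := boolP (j \in finsupp g).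
by rewrite /deg (big_fsetD1 j)//= leq_addr.
Qed.

Lemma expansion_has_csum (F : l2ball R J -> R[i]) a (z : l2ball R J) :
  expansion F a -> has_csum (fun g => a g * mon (val z) g) (F z) /\
  exists B, abs_bounded (fun g => a g * mon (val z) g) B.
Proof.
move=> /(_ z)[/summable_abs_bounded [B HB] ->]; split; last by exists B.
exact: abs_bounded_has_csum HB.
Qed.

Lemma monomialE (z : J -> R[i]) g : monomial z g = mon z g.
Proof. by []. Qed.

(** Kronecker substitution: along [curve S n t] the monomials of degree at most
    [n] supported in [S] become pairwise distinct powers of [t], all of them
    lower than the powers coming from the monomials of degree more than [n]. *)
Definition digit_weight S n (j : J) : nat := (n.+1 ^ index j S)%N.

(** Exceeds every digit sum arising from [box S n] ([digits_lt]), so reducing [order] modulo this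
    number recovers the digit sum. *)
Definition degree_weight S n : nat := (n * n.+1 ^ #|` S|).+1.

Definition curve S n (t : R) (j : J) : R[i] :=
  if j \in S then
    ((#|` S|.+1%:R)^-1 * t ^+ (degree_weight S n + digit_weight S n j))%:C
  else 0.

Definition order S n g : nat :=
  (degree_weight S n * deg g + \sum_(j <- S) g j * digit_weight S n j)%N.

(** Uniqueness of digits in base [n.+1]: the head of [s] carries the lowest digit, which is read off
    modulo [n.+1]. *)
Lemma digits_inj (s : seq J) n g h : uniq s ->
  {in s, forall j, (g j <= n)%N} -> {in s, forall j, (h j <= n)%N} ->
  (\sum_(j <- s) g j * n.+1 ^ index j s =
   \sum_(j <- s) h j * n.+1 ^ index j s)%N ->
  {in s, g =1 h}.
Proof.
elim: s => [//|i s IH] /= /andP[si us] gn hn.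
have E f : (\sum_(j <- i :: s) f j * n.+1 ^ index j (i :: s) =
    (\sum_(j <- s) f j * n.+1 ^ index j s) * n.+1 + f i)%N.
  rewrite big_cons /= eqxx expn0 muln1 addnC big_distrl /=; congr (_ + _)%N.
  apply: eq_big_seq => j js; have /negPf -> : i != j.
    by apply: contraNneq si => ->.
  by rewrite expnSr mulnA.
have gi := gn _ (mem_head _ _); have hi := hn _ (mem_head _ _).
rewrite [X in X = _ -> _]E [X in _ = X -> _]E => gh.
have ghi : g i = h i.
  by have /(congr1 (modn^~ n.+1)) := gh; rewrite !modnMDl !modn_small.
have /IH ghs : (\sum_(j <- s) g j * n.+1 ^ index j s =
    \sum_(j <- s) h j * n.+1 ^ index j s)%N.
  by move/eqP: gh; rewrite ghi eqn_add2r eqn_pmul2r// => /eqP.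
move=> j; rewrite inE => /predU1P[->//|]; apply: ghs => //.
- by move=> k ks; apply: gn; rewrite inE ks orbT.
- by move=> k ks; apply: hn; rewrite inE ks orbT.
Qed.

Lemma digits_lt S n g : g \in box S n ->
  (\sum_(j <- S) g j * digit_weight S n j < degree_weight S n)%N.
Proof.
rewrite mem_box => /andP[gn gS]; rewrite /degree_weight ltnS.
apply: (@leq_trans (\sum_(j <- S) g j * n.+1 ^ #|` S|)).
  by apply: leq_sum => j _; rewrite leq_mul2l leq_pexp2l ?orbT// index_size.
rewrite -big_distrl /= leq_mul2r; apply/orP; right.
apply: leq_trans gn; rewrite /deg leq_eqVlt; apply/orP; left; apply/eqP.
by apply/esym/big_fset_incl => // j _; rewrite mem_finsupp negbK => /eqP.
Qed.

(** Monomials of degree more than [n] have at least this order, so they cannot supply the lowest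
    power of [t] once the box has a nonzero coefficient. *)
Lemma order_lt S n g : g \in box S n ->
  (order S n g < n.+1 * degree_weight S n)%N.
Proof.
move=> gb; move: (gb); rewrite mem_box => /andP[gn gS].
have -> : (n.+1 * degree_weight S n =
    degree_weight S n * n + degree_weight S n)%N by lia.
by rewrite /order -addnS leq_add ?leq_mul2l ?gn ?orbT// digits_lt.
Qed.

Lemma order_inj S n : {in box S n &, injective (order S n)}.
Proof.
move=> g h gb hb; rewrite /order => E.
have := digits_lt gb; have := digits_lt hb => vh vg.
move: gb hb; rewrite !mem_box => /andP[gn gS] /andP[hn hS].
have V : (\sum_(j <- S) g j * digit_weight S n j =
    \sum_(j <- S) h j * digit_weight S n j)%N.
  have /(congr1 (modn^~ (degree_weight S n))) := E.
  by rewrite ![(degree_weight S n * _)%N]mulnC !modnMDl !modn_small.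
apply/fsfunP => j; have [jS|jS] := boolP (j \in S).
  apply: (digits_inj (fset_uniq S) _ _ V) => // i _; exact: leq_trans (le_deg _ _) _.
rewrite !fsfun_dflt//; first by apply: contra jS => /(fsubsetP hS).
by apply: contra jS => /(fsubsetP gS).
Qed.

Lemma mon_curve0 S n t g : ~~ (finsupp g `<=` S)%fset -> mon (curve S n t) g = 0.
Proof.
by move=> /fsubsetPn[j jg jS]; apply: (mon_eq0 jg); rewrite /curve (negPf jS).
Qed.

Lemma mon_curve S n t g : (finsupp g `<=` S)%fset ->
  mon (curve S n t) g =
  ((#|` S|.+1%:R)^-1 ^+ deg g * t ^+ order S n g)%:C.
Proof.
move=> gS; rewrite (eq_mon (y := fun j => (#|` S|.+1%:R)^-1%:C *
    (t ^+ (degree_weight S n + digit_weight S n j))%:C)); last first.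
  by move=> j /(fsubsetP gS) jS; rewrite /curve jS -rmorphM.
rewrite mon_scale rmorphM rmorphXn; congr (_ * _).
rewrite /mon /order (big_fset_incl _ gS) => [|j _]; last first.
  by rewrite mem_finsupp negbK => /eqP ->; rewrite expr0.
have -> : deg g = (\sum_(j <- S) g j)%N.
  by apply: big_fset_incl => // j _; rewrite mem_finsupp negbK => /eqP.
rewrite big_distrr -big_split /= -prodrXr rmorph_prod.
apply: eq_bigr => j _; rewrite -rmorphXn -exprM; congr (_ ^+ _)%:C; lia.
Qed.

Lemma curve_le S n t g : 0 <= t -> t <= 1 ->
  normc (mon (curve S n t) g) <=
  t ^+ (degree_weight S n * deg g) * normc (mon (curve S n 1) g).
Proof.
move=> t0 t1; have [gS|gS] := boolP (finsupp g `<=` S)%fset; last first.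
  by rewrite !mon_curve0// normc0 mulr0.
rewrite !mon_curve// !normc_real expr1n mulr1 mulrC.
have r0 : 0 <= (#|` S|.+1%:R : R)^-1 ^+ deg g by rewrite exprn_ge0.
rewrite !ger0_norm ?mulr_ge0 ?exprn_ge0//.
by rewrite ler_wpM2r// ler_wiXn2l// leq_addr.
Qed.

Lemma curve_ball S n t : 0 <= t -> t <= 1 ->
  exists z : l2ball R J, val z = curve S n t.
Proof.
move=> t0 t1.
have [] := @sum_sq_l2norm R J (curve S n t) 2^-1.
- by rewrite invr_ge0.
- move=> A.
  set s : R := #|` S|.+1%:R; have s1 : 1 <= s by rewrite ler1n.
  apply: (@le_trans _ _ (\sum_(j <- A | j \in S) s^-1 ^+ 2)).
    rewrite [leRHS]big_mkcond; apply: ler_sum => j _; rewrite /curve.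
    case: ifP => _; last by rewrite normc0 expr0n.
    rewrite normc_real ger0_norm ?mulr_ge0 ?exprn_ge0 ?invr_ge0 ?ler0n//.
    rewrite lerXn2r ?nnegrE ?mulr_ge0 ?exprn_ge0 ?invr_ge0 ?ler0n//.
    by rewrite ger_pMr ?invr_gt0 ?(lt_le_trans ltr01)// exprn_ile1.
  rewrite big_const_seq iter_addr_0.
  have : (count (fun j => j \in S) A <= #|` S|)%N.
    rewrite -size_filter; apply: uniq_leq_size; first by rewrite filter_uniq.
    by move=> j; rewrite mem_filter => /andP[].
  rewrite -(ler_nat R) => cS.
  rewrite -[_ *+ _]mulr_natl; set c : R := (count _ _)%:R.
  have {}cS : c <= s - 1 by rewrite /s -natr1 addrK.
  have s0 : 0 < s ^+ 2 by rewrite exprn_gt0// (lt_le_trans ltr01).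
  rewrite exprVn ler_pdivrMr//.
  (* At most [s - 1] coordinates are nonzero, each of modulus at most [s^-1], and
     [4 * (s - 1) <= s ^ 2]. *)
  by have := sqr_ge0 (s - 2); rewrite expr2 exprVn; nra.
move=> zoo z1.
have zb : l2ball R J (curve S n t) by split => //; lra.
by exists (exist (fun x => x \in l2ball R J) _ (mem_set zb)).
Qed.

(** Otherwise let [e] be the lowest order of a nonzero coefficient in the box. Orders being
    distinct, a single monomial [g0] attains it; the other terms and [F] itself are bounded by a
    constant times [t ^ e.+1], which forces [a g0 = 0] as [t] tends to 0. *)
Lemma expansion_vanish (F : l2ball R J -> R[i]) a S n (K : R) :
  expansion F a ->
  (forall t (z : l2ball R J), 0 < t -> t <= 1 -> val z = curve S n t ->
    normc (F z) <= K * t ^+ (n.+1 * degree_weight S n)) ->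
  forall g, g \in box S n -> a g = 0.
Proof.
move=> Fa FK g gb; apply: contrapT => /eqP ag.
pose P e := has (fun h => (a h != 0) && (order S n h == e)) (box S n).
have exP : exists e, P e by exists (order S n g); apply/hasP; exists g; rewrite ?ag ?eqxx.
have [e /hasP[g0 g0b /andP[ag0 /eqP g0e]] emin] := ex_minnP exP.
have g0S : (finsupp g0 `<=` S)%fset by move: g0b; rewrite mem_box => /andP[].
have eM : (e.+1 <= n.+1 * degree_weight S n)%N by rewrite -g0e order_lt.
have emin' h : h != g0 -> (finsupp h `<=` S)%fset -> a h != 0 ->
    (e.+1 <= order S n h)%N.
  move=> hg hS ah; have [hn|hn] := leqP (deg h) n.
    have hb : h \in box S n by rewrite mem_box hn hS.
    have : P (order S n h) by apply/hasP; exists h; rewrite ?ah ?eqxx.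
    move=> /emin; rewrite leq_eqVlt => /predU1P[ehE|//].
    by case/eqP: hg; apply: (order_inj hb g0b); rewrite g0e.
  apply: leq_trans eM _; apply: leq_trans (leq_addr _ _).
  by rewrite mulnC leq_mul2l hn orbT.
(* Absolute convergence at the endpoint [t = 1] supplies one constant [B] for the tails at every
   [t]. *)
have [z1 z1E] := @curve_ball S n 1 ler01 (lexx _).
have [_ [B HB]] := expansion_has_csum z1 Fa.
have B0 : 0 <= B by apply: le_trans (HB fset0); rewrite big_seq_fset0.
set r : R := (#|` S|.+1%:R)^-1 ^+ deg g0.
have r0 : 0 < r by rewrite exprn_gt0// invr_gt0 ltr0n.
have main t : 0 < t -> t <= 1 -> normc (a g0) * r <= t * (B + `|K|).
  move=> t0 t1; have [z zE] := @curve_ball S n t (ltW t0) t1.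
  have [zF _] := expansion_has_csum z Fa.
  have tail : normc (F z - a g0 * mon (val z) g0) <= t ^+ e.+1 * B.
    apply: (has_csum_le (A1 := [fset g0]%fset) zF) => A.
    rewrite fsub1set => g0A; rewrite (big_fsetD1 g0)//= addrC addrK.
    apply: le_trans (le_normc_sum _ _ _) _.
    apply: le_trans (ler_wpM2l _ (HB (A `\ g0)%fset)); last by rewrite exprn_ge0// ltW.
    rewrite mulr_sumr big_seq [leRHS]big_seq; apply: ler_sum => h.
    rewrite !inE => /andP[hg0 _].
    rewrite !normcM mulrCA zE z1E.
    have [->|ah] := eqVneq (a h) 0; first by rewrite normc0 !mul0r.
    rewrite ler_wpM2l ?normc_ge0//.
    have [hS|hS] := boolP (finsupp h `<=` S)%fset; last first.
      by rewrite !mon_curve0// normc0 mulr0.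
    rewrite !mon_curve// !normc_real expr1n mulr1.
    rewrite !ger0_norm ?mulr_ge0 ?exprn_ge0 ?invr_ge0 ?ler0n ?(ltW t0)//.
    rewrite mulrC ler_wpM2r ?exprn_ge0 ?invr_ge0 ?ler0n//.
    by rewrite ler_wiXn2l ?(ltW t0)// emin'.
  have lead : normc (a g0 * mon (val z) g0) = normc (a g0) * r * t ^+ e.
    rewrite normcM zE mon_curve// normc_real g0e -mulrA.
    by rewrite ger0_norm// mulr_ge0 ?exprn_ge0 ?(ltW t0) ?invr_ge0 ?ler0n.
  have FB : normc (F z) <= `|K| * t ^+ e.+1.
    apply: le_trans (FK t z t0 t1 zE) _.
    apply: le_trans (ler_wpM2r _ (ler_norm K)) _; first by rewrite exprn_ge0// ltW.
    by rewrite ler_wpM2l// ler_wiXn2l ?(ltW t0).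
  have te : 0 < t ^+ e by rewrite exprn_gt0.
  rewrite -(ler_pM2r te) -lead.
  have := normc_tri (a g0 * mon (val z) g0) (F z) 0.
  rewrite !subr0 normcB => /le_trans -> //.
  apply: le_trans (lerD tail FB) _.
  by rewrite exprS le_eqVlt; apply/orP; left; apply/eqP; ring.
have ar0 : 0 < normc (a g0) * r.
  by rewrite mulr_gt0// lt_neqAle normc_ge0 eq_sym normc_eq0 ag0.
set c := normc (a g0) * r in main ar0.
have D0 : 0 < B + `|K| + c by rewrite ltr_wpDl// addr_ge0.
(* Adding [c] to the denominator makes it positive and keeps [t] at most 1; [t * (B + |K|)] is then
   below [c]. *)
have t0 : 0 < c / (B + `|K| + c) / 2 by rewrite !divr_gt0.
have t1 : c / (B + `|K| + c) / 2 <= 1.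
  rewrite ler_pdivrMr// mul1r ler_pdivrMr//.
  by have := normr_ge0 K; move: B0 ar0; nra.
have := main _ t0 t1; apply/negP; rewrite -ltNge.
have -> : c / (B + `|K| + c) / 2 * (B + `|K|) = (c * (B + `|K|)) / (2 * (B + `|K| + c)).
  by field; rewrite gt_eqF.
by rewrite ltr_pdivrMr ?mulr_gt0//; have := normr_ge0 K; move: B0 ar0; nra.
Qed.

Lemma expansion_unique (F : l2ball R J -> R[i]) a b :
  expansion F a -> expansion F b -> a = b.
Proof.
move=> Fa Fb; apply/funext => g; apply/eqP; rewrite -subr_eq0; apply/eqP.
have Fab : expansion (fun=> 0 : R[i]) (fun g => a g - b g).
  move=> z; have [za [A HA]] := expansion_has_csum z Fa.
  have [zb [B HB]] := expansion_has_csum z Fb.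
  have abE g' : a g' * mon (val z) g' + -1 * (b g' * mon (val z) g') =
      (a g' - b g') * mon (val z) g' by rewrite mulN1r mulrBl.
  split.
    apply: (@abs_bounded_summable _ _ _ (A + B)) => X.
    apply: le_trans (lerD (HA X) (HB X)); rewrite -big_split /=.
    apply: ler_sum => h _; rewrite monomialE mulrBl.
    by apply: le_trans (le_normcD _ _) _; rewrite normcN.
  apply/esym/has_csum_csum; have := has_csumD za (has_csumZ (-1) zb).
  by rewrite mulN1r subrr; apply: eq_has_csum => h; rewrite abE.
apply: (@expansion_vanish _ _ (finsupp g) (deg g) 0 Fab).
  by move=> t z _ _ _; rewrite normc0 mul0r.
by rewrite mem_box leqnn fsubset_refl.
Qed.

Lemma coefs_eq (F : l2ball R J -> R[i]) a : expansion F a -> coefs F = a.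
Proof.
move=> Fa; rewrite /coefs; case: xgetP => [b _ Fb|/(_ a)//].
exact: expansion_unique Fb Fa.
Qed.

End Vanishing.

(** * Reproducing kernel Hilbert spaces *)

(** The restriction [e <= 1] lets a quadratic error [e ^ 2] be absorbed into a linear one. *)
Lemma small_le0 (R : realType) (x K : R) :
  (forall e, 0 < e -> e <= 1 -> x <= e * K) -> x <= 0.
Proof.
move=> xK; rewrite leNgt; apply/negP => x0.
have D0 : 0 < `|K| + x by rewrite ltr_wpDl.
have e0 : 0 < x / (`|K| + x) / 2 by rewrite !divr_gt0.
have e1 : x / (`|K| + x) / 2 <= 1.
  by rewrite ler_pdivrMr// mul1r ler_pdivrMr//; have := normr_ge0 K; nra.
have := xK _ e0 e1; apply/negP; rewrite -ltNge.
have -> : x / (`|K| + x) / 2 * K = x * K / ((`|K| + x) * 2).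
  by field; rewrite gt_eqF.
rewrite ltr_pdivrMr ?mulr_gt0//.
by have := ler_norm K; have := normr_ge0 K; nra.
Qed.

Section RkhsTheory.
Variables (R : realType) (X : Type) (k : X -> X -> R[i]) (H : rkhs k).
Local Notation Hfun := (rkhs_fun H).
Local Notation ip := (rkhs_ip H).
Local Notation nrm := (rkhs_norm H).
Implicit Types (f g h : X -> R[i]) (c : R[i]) (x : X) (s t : seq (R[i] * X)).

Lemma rkhs_memZ c f : Hfun f -> Hfun (c *: f).
Proof. by move=> Hf; rewrite -[c *: f]addr0; apply: rkhs_lin => //; exact: rkhs_0. Qed.

Lemma rkhs_memD f g : Hfun f -> Hfun g -> Hfun (f + g).
Proof. by move=> Hf Hg; rewrite -[f]scale1r; exact: rkhs_lin. Qed.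

Lemma rkhs_memB f g : Hfun f -> Hfun g -> Hfun (f - g).
Proof. by move=> Hf Hg; rewrite -scaleN1r; apply: rkhs_memD => //; exact: rkhs_memZ. Qed.

Lemma rkhs_mem_sum (I : Type) (r : seq I) (F : I -> X -> R[i]) :
  (forall i, Hfun (F i)) -> Hfun (\sum_(i <- r) F i).
Proof.
move=> HF; elim: r => [|i r IH]; first by rewrite big_nil; exact: rkhs_0.
by rewrite big_cons; exact: rkhs_memD.
Qed.

Lemma ip0l h : Hfun h -> ip 0 h = 0.
Proof.
move=> Hh; have := rkhs_ip_lin (- 1) (@rkhs_0 _ _ _ H) (@rkhs_0 _ _ _ H) Hh.
by rewrite scaler0 addr0 mulN1r addNr.
Qed.

Lemma ipZl c f h : Hfun f -> Hfun h -> ip (c *: f) h = c * ip f h.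
Proof.
move=> Hf Hh; rewrite -[c *: f]addr0 rkhs_ip_lin ?ip0l ?addr0//; exact: rkhs_0.
Qed.

Lemma ipDl f g h : Hfun f -> Hfun g -> Hfun h -> ip (f + g) h = ip f h + ip g h.
Proof. by move=> Hf Hg Hh; rewrite -[f]scale1r rkhs_ip_lin// scale1r mul1r. Qed.

Lemma ip_conj f g : Hfun f -> Hfun g -> conjc (ip f g) = ip g f.
Proof. by move=> Hf Hg; rewrite -rkhs_ip_conj. Qed.

Lemma ipZr c f h : Hfun f -> Hfun h -> ip h (c *: f) = conjc c * ip h f.
Proof.
move=> Hf Hh; rewrite -ip_conj//; last exact: rkhs_memZ.
by rewrite ipZl// rmorphM /= ip_conj.
Qed.

Lemma ipDr f g h : Hfun f -> Hfun g -> Hfun h -> ip h (f + g) = ip h f + ip h g.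
Proof.
move=> Hf Hg Hh; rewrite -ip_conj//; last exact: rkhs_memD.
by rewrite ipDl// rmorphD /= !ip_conj.
Qed.

Lemma ipBl f g h : Hfun f -> Hfun g -> Hfun h -> ip (f - g) h = ip f h - ip g h.
Proof.
by move=> Hf Hg Hh; rewrite -scaleN1r ipDl ?ipZl ?mulN1r//; exact: rkhs_memZ.
Qed.

Lemma ipBr f g h : Hfun f -> Hfun g -> Hfun h -> ip h (f - g) = ip h f - ip h g.
Proof.
move=> Hf Hg Hh; rewrite -scaleN1r ipDr ?ipZr//; last exact: rkhs_memZ.
by rewrite rmorphN rmorph1 mulN1r.
Qed.

Lemma ip_suml (I : Type) (r : seq I) (F : I -> X -> R[i]) h :
  (forall i, Hfun (F i)) -> Hfun h ->
  ip (\sum_(i <- r) F i) h = \sum_(i <- r) ip (F i) h.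
Proof.
move=> HF Hh; elim: r => [|i r IH]; first by rewrite !big_nil ip0l.
by rewrite !big_cons ipDl ?IH//; exact: rkhs_mem_sum.
Qed.

Lemma ip_sumr (I : Type) (r : seq I) (F : I -> X -> R[i]) h :
  (forall i, Hfun (F i)) -> Hfun h ->
  ip h (\sum_(i <- r) F i) = \sum_(i <- r) ip h (F i).
Proof.
move=> HF Hh; rewrite -ip_conj//; last exact: rkhs_mem_sum.
by rewrite ip_suml// rmorph_sum; apply: eq_bigr => i _ /=; rewrite ip_conj.
Qed.

Lemma nrm_ge0 f : 0 <= nrm f.
Proof. exact: sqrtr_ge0. Qed.

Lemma ipff f : Hfun f -> ip f f = (nrm f ^+ 2)%:C.
Proof.
move=> Hf; have f0 := rkhs_ip_ge0 Hf.
rewrite /rkhs_norm /ip_norm sqr_sqrtr; last first.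
  by move: f0; rewrite lecE => /andP[].
by rewrite RRe_real// ger0_real.
Qed.

Lemma nrm_sq f : Hfun f -> nrm f ^+ 2 = Re (ip f f).
Proof. by move=> Hf; rewrite ipff. Qed.

Lemma nrmD_sq f g : Hfun f -> Hfun g ->
  nrm (f + g) ^+ 2 = nrm f ^+ 2 + nrm g ^+ 2 + 2 * Re (ip f g).
Proof.
move=> Hf Hg; have Hfg := rkhs_memD Hf Hg.
rewrite !nrm_sq// !(ipDl, ipDr)// !ReD -(ip_conj Hf Hg).
by case: (ip f g) => a b /=; ring.
Qed.

Lemma nrmZ c f : Hfun f -> nrm (c *: f) = normc c * nrm f.
Proof.
move=> Hf; apply: (@pexpIrn _ 2) => //; rewrite ?nnegrE ?mulr_ge0 ?normc_ge0 ?nrm_ge0//.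
rewrite exprMn nrm_sq; last exact: rkhs_memZ.
rewrite ipZl ?ipZr//; last exact: rkhs_memZ.
by rewrite mulrA mulcJ ipff// -rmorphM.
Qed.

Lemma nrmB_sq f g : Hfun f -> Hfun g ->
  nrm (f - g) ^+ 2 = nrm f ^+ 2 + nrm g ^+ 2 - 2 * Re (ip f g).
Proof.
move=> Hf Hg; rewrite -scaleN1r nrmD_sq ?nrmZ//; last exact: rkhs_memZ.
by rewrite normcN normc1 mul1r ipZr// rmorphN rmorph1 mulN1r ReN mulrN.
Qed.

Lemma nrmB f g : Hfun f -> Hfun g -> nrm (f - g) = nrm (g - f).
Proof.
move=> Hf Hg; rewrite -opprB -scaleN1r nrmZ; last exact: rkhs_memB.
by rewrite normcN normc1 mul1r.
Qed.

Lemma nrm0 : nrm 0 = 0.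
Proof. by rewrite -(scale0r (0 : X -> R[i])) nrmZ ?normc0 ?mul0r//; exact: rkhs_0. Qed.

Lemma cauchy_schwarz f g : Hfun f -> Hfun g -> normc (ip f g) <= nrm f * nrm g.
Proof.
move=> Hf Hg; have [g0|g0] := eqVneq (nrm g) 0.
  have /(rkhs_ip_eq0 Hg) -> : ip g g = 0 by rewrite ipff// g0 expr0n.
  by rewrite -[ip f _]conjcK ip_conj ?ip0l ?rmorph0 ?normc0 ?nrm0 ?mulr0//; exact: rkhs_0.
have gp : 0 < nrm g by rewrite lt_neqAle eq_sym g0 nrm_ge0.
pose c : R[i] := ip f g / (nrm g ^+ 2)%:C.
have Hcg : Hfun (c *: g) by exact: rkhs_memZ.
have := sqr_ge0 (nrm (f - c *: g)); rewrite nrmB_sq// nrmZ// exprMn ipZr//.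
have -> : conjc c * ip f g = (normc (ip f g) ^+ 2 / nrm g ^+ 2)%:C.
  rewrite /c rmorphM mulrAC [conjc (ip f g) * _]mulrC mulcJ.
  rewrite [RHS]rmorphM; congr (_ * _).
  by apply: etrans (conjc_inv _) _; rewrite conjc_real fmorphV.
have -> : normc c ^+ 2 = normc (ip f g) ^+ 2 / nrm g ^+ 4.
  rewrite /c normcM normcV normc_real ger0_norm ?exprn_ge0 ?nrm_ge0//.
  by rewrite exprMn exprVn -exprM.
have -> : normc (ip f g) ^+ 2 / nrm g ^+ 4 * nrm g ^+ 2 =
    normc (ip f g) ^+ 2 / nrm g ^+ 2 by field.
rewrite /=; set q := _ / _ => q0.
have : q <= nrm f ^+ 2 by lra.
rewrite /q ler_pdivrMr ?exprn_gt0// -exprMn ler_pXn2r//.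
all: by rewrite nnegrE ?normc_ge0 ?mulr_ge0 ?nrm_ge0.
Qed.

Lemma nrmD_le f g : Hfun f -> Hfun g -> nrm (f + g) <= nrm f + nrm g.
Proof.
move=> Hf Hg; rewrite -(@ler_pXn2r _ 2) ?nnegrE ?addr_ge0 ?nrm_ge0//.
rewrite nrmD_sq// sqrrD.
have := Re_le_normc (ip f g); have := cauchy_schwarz Hf Hg; lra.
Qed.

Lemma eval_le f x : Hfun f -> normc (f x) <= nrm f * nrm (k^~ x).
Proof.
move=> Hf; rewrite -(rkhs_reproducing x Hf).
by apply: cauchy_schwarz => //; exact: rkhs_kernel.
Qed.

(** * Kernel combinations, membership by duality, multipliers *)

Definition kcomb s : X -> R[i] := \sum_(p <- s) p.1 *: (k^~ p.2).

Lemma kcomb_mem s : Hfun (kcomb s).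
Proof. by apply: rkhs_mem_sum => p; apply: rkhs_memZ; exact: rkhs_kernel. Qed.

Lemma ip_kcomb f s : Hfun f -> ip f (kcomb s) = \sum_(p <- s) conjc p.1 * f p.2.
Proof.
move=> Hf; rewrite ip_sumr//; last first.
  by move=> p; apply: rkhs_memZ; exact: rkhs_kernel.
apply: eq_bigr => p _; rewrite ipZr ?rkhs_reproducing//; exact: rkhs_kernel.
Qed.

Lemma kcomb_cat s t : kcomb (s ++ t) = kcomb s + kcomb t.
Proof. by rewrite /kcomb big_cat. Qed.

Lemma kcomb_scale c s : kcomb [seq (c * p.1, p.2) | p <- s] = c *: kcomb s.
Proof.
by rewrite /kcomb big_map scaler_sumr; apply: eq_bigr => p _; rewrite scalerA.
Qed.

Lemma kcombE s x : kcomb s x = \sum_(p <- s) p.1 * k x p.2.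
Proof. by rewrite /kcomb fct_sumE; apply: eq_bigr. Qed.

Lemma kcomb_norm_sq s :
  (nrm (kcomb s) ^+ 2)%:C = \sum_(p <- s) \sum_(q <- s) conjc p.1 * q.1 * k p.2 q.2.
Proof.
rewrite -ipff; last exact: kcomb_mem.
rewrite ip_kcomb; last exact: kcomb_mem.
apply: eq_bigr => p _; rewrite kcombE mulr_sumr.
by apply: eq_bigr => q _; rewrite mulrA.
Qed.

(** [G] is reconstructed as the limit of a sequence of kernel combinations
    minimising [nrm f ^+ 2 - 2 * Re <G, f>]. *)
Lemma rkhs_membership (G : X -> R[i]) (C : R) : 0 <= C ->
  (forall s, normc (\sum_(p <- s) conjc p.1 * G p.2) <= C * nrm (kcomb s)) ->
  Hfun G /\ nrm G <= C.
Proof.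
move=> C0 GC; pose L s := \sum_(p <- s) conjc p.1 * G p.2.
pose Jf s := nrm (kcomb s) ^+ 2 - 2 * Re (L s).
pose E := range Jf.
have hE : has_inf E.
  split; first by exists (Jf [::]); exists [::].
  (* Completing the square in [|f| ^ 2 - 2 * C * |f|]. *)
  exists (- C ^+ 2) => _ [s _ <-]; rewrite /Jf.
  have := Re_le_normc (L s); have := GC s; rewrite -/(L s).
  have := sqr_ge0 (nrm (kcomb s) - C); rewrite sqrrB; lra.
pose mu := inf E.
have muJ s : mu <= Jf s by apply: ge_inf; [exact: hE.2|exists s].
have Lcat s t : L (s ++ t) = L s + L t by rewrite /L big_cat.
have Lscale c s : L [seq (c * p.1, p.2) | p <- s] = conjc c * L s.
  by rewrite /L big_map mulr_sumr; apply: eq_bigr => p _; rewrite rmorphM mulrA.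
(* Parallelogram law: the midpoint of two near-minimisers also has [Jf] at least [mu], so they are
   close to each other. *)
have par s t : nrm (kcomb s - kcomb t) ^+ 2 <= 2 * (Jf s - mu) + 2 * (Jf t - mu).
  have Hs := kcomb_mem s; have Ht := kcomb_mem t.
  pose c : R[i] := (2^-1)%:C.
  have := muJ [seq (c * p.1, p.2) | p <- s ++ t].
  rewrite {1}/Jf kcomb_scale Lscale kcomb_cat Lcat nrmZ; last exact: rkhs_memD.
  rewrite exprMn normc_real ger0_norm ?invr_ge0// (nrmB_sq Hs Ht) (nrmD_sq Hs Ht).
  rewrite /Jf /c conjc_real.
  case: (L s) => a b; case: (L t) => a' b' /=.
  rewrite !mul0r !subr0 expr2; lra.
(* First variation in the direction of the kernel at [x]: a near-minimiser almost takes the value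
   [G x] there. The step length [l = (ka + 1)^-1] is close to the optimal [ka^-1] but stays defined
   when [ka = 0]. *)
have pt s x : normc (kcomb s x - G x) ^+ 2 <=
    (nrm (k^~ x) ^+ 2 + 1) * (Jf s - mu).
  have Hs := kcomb_mem s; have Hx := rkhs_kernel H x.
  set D := kcomb s x - G x; set ka := nrm (k^~ x) ^+ 2.
  have ka0 : 0 <= ka by exact: sqr_ge0.
  pose l : R := (ka + 1)^-1.
  pose c : R[i] := - (l%:C * D).
  have := muJ (s ++ [:: (c, x)]).
  rewrite /Jf kcomb_cat Lcat.
  have -> : kcomb [:: (c, x)] = c *: k^~ x by rewrite /kcomb big_seq1.
  have -> : L [:: (c, x)] = conjc c * G x by rewrite /L big_seq1.
  rewrite nrmD_sq ?nrmZ//; last exact: rkhs_memZ.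
  rewrite ipZr// rkhs_reproducing// exprMn -/ka ReD.
  have -> : normc c ^+ 2 = l ^+ 2 * normc D ^+ 2.
    by rewrite /c normcN normcM normc_real exprMn real_normK ?num_real.
  have E1 : Re (conjc c * kcomb s x) - Re (conjc c * G x) = - (l * normc D ^+ 2).
    have -> : conjc c = - (l%:C * conjc D).
      by rewrite /c rmorphN rmorphM; congr (- (_ * _)); exact: conjc_real.
    rewrite -ReN -ReD -mulrBr -/D mulNr -mulrA [conjc D * _]mulrC mulcJ ReN.
    by rewrite -rmorphM.
  set d := normc D ^+ 2 in E1 *; move=> muJ'.
  have lk : l * (ka + 1) = 1 by rewrite mulVf// gt_eqF// ltr_wpDl.
  have l0 : 0 < l by rewrite invr_gt0 ltr_wpDl.
  have d0 : 0 <= d by exact: sqr_ge0.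
  have : d * l * (2 - l * ka) <= Jf s - mu.
    by rewrite /Jf; move: muJ' E1; lra.
  have lk1 : l * ka <= 1 by move: lk; rewrite mulrDr mulr1; lra.
  move=> dJ; have : d * l <= Jf s - mu.
    have dl0 : 0 <= d * l by rewrite (mulr_ge0 d0 (ltW l0)).
    apply: le_trans dJ; rewrite ler_peMr//; lra.
  rewrite /l ler_pdivrMr ?ltr_wpDl//; by rewrite mulrC.
have seqP (n : nat) : {s | Jf s < mu + n.+1%:R^-1}.
  apply: cid; have n0 : 0 < (n.+1%:R : R)^-1 by rewrite invr_gt0 ltr0n.
  by have [_ [s _ <-] ?] := inf_adherent n0 hE; exists s.
pose sq n := projT1 (seqP n).
have sqP n : Jf (sq n) - mu <= n.+1%:R^-1.
  by rewrite lerBlDl; apply/ltW; exact: (projT2 (seqP n)).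
have harm (e : R) : 0 < e -> exists N : nat, forall n, (N <= n)%N -> n.+1%:R^-1 <= e.
  move=> e0; have := @cvg_harmonic R => /cvgrPdist_le /(_ _ e0)[N _ HN].
  exists N => n /HN; rewrite /= sub0r normrN ger0_norm// invr_ge0 ler0n.
have [||g Hg gcvg] := @rkhs_complete _ _ _ H (fun n => kcomb (sq n)).
- by move=> n; exact: kcomb_mem.
(* With both defects at most [e ^ 2 / 8], [par] bounds the squared distance by [e ^ 2 / 2]. *)
- move=> e e0; have e4 : 0 < e ^+ 2 / 8 by rewrite divr_gt0 ?exprn_gt0.
  have [N HN] := harm _ e4; exists N => m n Nm Nn.
  rewrite -/(rkhs_norm H _) -(@ltr_pXn2r _ 2) ?nnegrE ?nrm_ge0 ?(ltW e0)//.
  apply: le_lt_trans (par _ _) _.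
  have := le_trans (sqP m) (HN _ Nm); have := le_trans (sqP n) (HN _ Nn).
  have : 0 < e ^+ 2 by rewrite exprn_gt0.
  lra.
have close (e : R) : 0 < e -> exists n, nrm (kcomb (sq n) - g) <= e /\ Jf (sq n) - mu <= e.
  move=> e0; have [N HN] := harm _ e0.
  move: gcvg => /cvgrPdist_le /(_ _ e0)[M _ HM].
  exists (maxn N M); split; last by apply: le_trans (sqP _) (HN _ (leq_maxl _ _)).
  have /= := HM _ (leq_maxr N M).
  by rewrite sub0r normrN ger0_norm//; exact: nrm_ge0.
have gG : g = G.
  apply/funext => x; apply/eqP; rewrite -subr_eq0 -normc_eq0 -sqrf_eq0 eq_le sqr_ge0 andbT.
  set ka := nrm (k^~ x) ^+ 2.
  (* From [(p + q) ^ 2 <= 2 * (p ^ 2 + q ^ 2)] with [p ^ 2 <= e * ka] and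
     [q ^ 2 <= (ka + 1) * e]. *)
  apply: (@small_le0 _ _ (4 * ka + 2)) => e e0 e1.
  have [n [ng nJ]] := close _ e0.
  have Hu := kcomb_mem (sq n).
  have H1 := pt (sq n) x; rewrite -/ka in H1.
  have H2 : normc (kcomb (sq n) x - g x) <= nrm (kcomb (sq n) - g) * nrm (k^~ x).
    exact: (eval_le x (rkhs_memB Hu Hg)).
  have H3 := normc_tri (g x) (kcomb (sq n) x) (G x).
  rewrite normcB in H2.
  set p := normc (g x - kcomb _ _) in H2 H3; set q := normc (kcomb _ _ - _) in H1 H3.
  have p0 : 0 <= p by exact: normc_ge0.
  have q0 : 0 <= q by exact: normc_ge0.
  have ka0 : 0 <= ka by exact: sqr_ge0.
  have pk : p ^+ 2 <= e * ka.
    apply: (@le_trans _ _ ((nrm (kcomb (sq n) - g) * nrm (k^~ x)) ^+ 2)).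
      by rewrite lerXn2r ?nnegrE ?mulr_ge0 ?nrm_ge0.
    rewrite exprMn -/ka ler_wpM2r//; have n0 := nrm_ge0 (kcomb (sq n) - g); nra.
  have qk : q ^+ 2 <= (ka + 1) * e.
    by apply: le_trans H1 _; rewrite ler_wpM2l// addr_ge0.
  have n0 := normc_ge0 (g x - G x).
  apply: (@le_trans _ _ ((p + q) ^+ 2)).
    by rewrite lerXn2r ?nnegrE ?addr_ge0.
  have := sqr_ge0 (p - q); rewrite sqrrB sqrrD; nra.
rewrite -gG; split=> //.
have [->//|g0] := eqVneq (nrm g) 0.
have gp : 0 < nrm g by rewrite lt_neqAle eq_sym g0 nrm_ge0.
(* Replace one factor of [<g, g>] by a kernel combination close to [g]; its pairing with [g] is the
   functional bounded by [C]. *)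
suff : nrm g ^+ 2 - C * nrm g <= 0 by rewrite subr_le0 expr2 ler_pM2r.
apply: (@small_le0 _ _ (nrm g + C)) => e e0 e1.
have [n [ng _]] := close _ e0.
have Hu := kcomb_mem (sq n).
have E1 : nrm g ^+ 2 = Re (ip (g - kcomb (sq n)) g) + Re (ip g (kcomb (sq n))).
  rewrite nrm_sq// ipBl// ReD ReN -(ip_conj Hg Hu).
  by case: (ip g (kcomb _)) => a b /=; rewrite subrK.
have E2 : Re (ip g (kcomb (sq n))) <= C * nrm (kcomb (sq n)).
  apply: le_trans (Re_le_normc _) _; rewrite ip_kcomb// gG; exact: GC.
have E3 : Re (ip (g - kcomb (sq n)) g) <= e * nrm g.
  apply: le_trans (Re_le_normc _) _.
  apply: le_trans (cauchy_schwarz (rkhs_memB Hg Hu) Hg) _.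
  by rewrite ler_wpM2r ?nrm_ge0// nrmB.
have E4 : nrm (kcomb (sq n)) <= e + nrm g.
  rewrite -[kcomb _](subrK g); apply: le_trans (nrmD_le (rkhs_memB Hu Hg) Hg) _.
  by rewrite lerD2r.
have := ler_wpM2l C0 E4; lra.
Qed.

(** The adjoint of multiplication by [Phi] sends the kernel at [x] to [conjc (Phi x)] times itself.
    A bound on this map over kernel combinations bounds the pairings of [Phi \* f] with them, and
    [rkhs_membership] applies. *)
Lemma multiplier_bound (Phi : X -> R[i]) (C : R) : 0 <= C ->
  (forall s, nrm (kcomb [seq (p.1 * conjc (Phi p.2), p.2) | p <- s]) <=
             C * nrm (kcomb s)) ->
  forall f, Hfun f -> Hfun (Phi \* f) /\ nrm (Phi \* f) <= C * nrm f.
Proof.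
move=> C0 PC f Hf; apply: rkhs_membership; first by rewrite mulr_ge0 ?nrm_ge0.
move=> s; have := ip_kcomb [seq (p.1 * conjc (Phi p.2), p.2) | p <- s] Hf.
rewrite big_map /= (eq_bigr (fun p => conjc p.1 * (Phi \* f) p.2)); last first.
  move=> p _; rewrite rmorphM -mulrA; congr (_ * (_ * _)); exact: conjcK.
move=> <-; apply: le_trans (cauchy_schwarz Hf (kcomb_mem _)) _.
by rewrite -mulrA mulrCA ler_wpM2l ?nrm_ge0.
Qed.

Lemma mult_norm_le (Phi : X -> R[i]) f : multiplier H Phi -> Hfun f ->
  nrm (Phi \* f) <= mult_norm H Phi * nrm f.
Proof.
move=> [PH [c Pc]] Hf.
have [f0|f0] := eqVneq (nrm f) 0.
  by apply: le_trans (Pc _ Hf) _; rewrite f0 !mulr0.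
have fp : 0 < nrm f by rewrite lt_neqAle eq_sym f0 nrm_ge0.
pose c' : R[i] := ((nrm f)^-1)%:C.
have nc' : normc c' = (nrm f)^-1 by rewrite normc_real ger0_norm// invr_ge0 ltW.
have Hcf : Hfun (c' *: f) by exact: rkhs_memZ.
have n1 : nrm (c' *: f) <= 1 by rewrite nrmZ// nc' mulVf.
have PE : Phi \* (c' *: f) = c' *: (Phi \* f).
  by apply/funext => x /=; exact: mulrCA.
rewrite -ler_pdivrMr// mulrC -nc' -nrmZ; last exact: PH.
rewrite -PE; apply: ub_le_sup; last by exists (c' *: f).
exists `|c| => _ [h [Hh h1] <-]; apply: le_trans (Pc _ Hh) _.
apply: (@le_trans _ _ (`|c| * nrm h)); first by rewrite ler_wpM2r ?nrm_ge0// ler_norm.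
by rewrite ler_piMr.
Qed.

End RkhsTheory.

(** * Monomials in the Drury-Arveson space *)

Lemma weighted_cauchy_schwarz (R : realType) (I : Type) (r : seq I) (w a b : I -> R) :
  (forall i, 0 <= w i) ->
  (\sum_(i <- r) w i * (a i * b i)) ^+ 2 <=
  (\sum_(i <- r) w i * a i ^+ 2) * (\sum_(i <- r) w i * b i ^+ 2).
Proof.
move=> w0; set P := \sum_(i <- r) _; set X := \sum_(i <- r) _ * a _ ^+ 2.
set Y := \sum_(i <- r) _.
have q s t : 0 <= X * t ^+ 2 - 2 * P * s * t + Y * s ^+ 2.
  have -> : X * t ^+ 2 - 2 * P * s * t + Y * s ^+ 2 =
      \sum_(i <- r) w i * (a i * t - b i * s) ^+ 2.
    rewrite /X /P /Y !(mulr_suml, mulr_sumr) -sumrB -big_split /=.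
    by apply: eq_bigr => i _; ring.
  by apply: sumr_ge0 => i _; rewrite mulr_ge0// sqr_ge0.
have X0 : 0 <= X by apply: sumr_ge0 => i _; rewrite mulr_ge0// sqr_ge0.
have Y0 : 0 <= Y by apply: sumr_ge0 => i _; rewrite mulr_ge0// sqr_ge0.
move: Y0; rewrite le_eqVlt => /predU1P[/esym Y0|Y0].
  (* If [Y = 0], the form at this point equals [- P ^ 2 * (X + 2)], so [P = 0]. *)
  have := q (X + 1) P; rewrite Y0 mul0r addr0 mulr0.
  have := sqr_ge0 P; nra.
have := q P Y.
have -> : X * Y ^+ 2 - 2 * P * P * Y + Y * P ^+ 2 = Y * (X * Y - P ^+ 2) by ring.
by rewrite pmulr_rge0// subr_ge0.
Qed.

Section DruryArveson.
Variables (R : realType) (J : choiceType) (H : drury_arveson R J).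
Local Notation multi_index := {fsfun J -> nat with 0%N}.
Local Notation X := (l2ball R J).
Local Notation Hfun := (rkhs_fun H).
Local Notation ip := (rkhs_ip H).
Local Notation nrm := (rkhs_norm H).
Local Notation C := R[i].
Implicit Types (g h : multi_index) (A : {fset multi_index}) (z : X).

Definition monz g : X -> C := fun z => mon (val z) g.

(** [mult g] is the inverse of the squared norm of the monomial of index [g]. *)
Definition polyz A (e : multi_index -> C) : X -> C :=
  fun z => \sum_(g <- A) (mult g)%:R * (e g * mon (val z) g).

Lemma mult_normc g : normc ((mult g)%:R : C) = (mult g)%:R.
Proof. by rewrite -(rmorph_nat (real_complex R)) normc_real ger0_norm. Qed.

Lemma mult_neq0 g : ((mult g)%:R : C) != 0.
Proof. by rewrite pnatr_eq0 -lt0n mult_gt0. Qed.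

(** Inserting the expansion of the kernel into the squared norm of [kcomb s] gives a sum of the
    nonnegative terms on the left, over all [g]; a finite part is at most the whole. *)
Lemma kernel_bessel (s : seq (C * X)) A :
  \sum_(g <- A) (mult g)%:R *
    normc (\sum_(p <- s) conjc p.1 * mon (val p.2) g) ^+ 2 <=
  nrm (kcomb (da_kernel R J) s) ^+ 2.
Proof.
pose T g := \sum_(p <- s) conjc p.1 * mon (val p.2) g.
have fs : has_csum (fun g => ((mult g)%:R * normc (T g) ^+ 2)%:C)
    ((nrm (kcomb (da_kernel R J) s) ^+ 2)%:C).
  rewrite kcomb_norm_sq.
  have := has_csum_sum s (fun p => has_csum_sum s (fun q =>
    has_csumZ (conjc p.1 * q.1) (has_csum_kernel p.2 q.2))).
  apply: eq_has_csum => g.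
  rewrite realcM realc_nat -mulcJ /T conjc_sum mulr_suml mulr_sumr.
  apply: eq_bigr => p _; rewrite !mulr_sumr; apply: eq_bigr => q _.
  by rewrite conjcM conjcK; ring.
by apply: has_csum_ge_partial fs => g; rewrite mulr_ge0 ?sqr_ge0.
Qed.

(** Pairing with a kernel combination is estimated by weighted Cauchy-Schwarz and [kernel_bessel];
    [rkhs_membership] turns this into membership and a norm bound. *)
Lemma polyz_norm A (e : multi_index -> C) :
  Hfun (polyz A e) /\
  nrm (polyz A e) ^+ 2 <= \sum_(g <- A) (mult g)%:R * normc (e g) ^+ 2.
Proof.
set Q := \sum_(g <- A) _.
have Q0 : 0 <= Q by apply: sumr_ge0 => g _; rewrite mulr_ge0 ?sqr_ge0.
have [] := @rkhs_membership _ _ _ H (polyz A e) (Num.sqrt Q).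
- exact: sqrtr_ge0.
- move=> s.
  pose T g := \sum_(p <- s) conjc p.1 * mon (val p.2) g.
  have -> : \sum_(p <- s) conjc p.1 * polyz A e p.2 =
      \sum_(g <- A) (mult g)%:R * (e g * T g).
    rewrite /polyz; under eq_bigr do rewrite mulr_sumr.
    rewrite exchange_big /=; apply: eq_bigr => g _.
    rewrite /T !mulr_sumr; apply: eq_bigr => p _; by ring.
  rewrite -(@ler_pXn2r _ 2) ?nnegrE ?normc_ge0 ?mulr_ge0 ?sqrtr_ge0 ?nrm_ge0//.
  rewrite exprMn sqr_sqrtr//.
  apply: (@le_trans _ _ ((\sum_(g <- A) (mult g)%:R * (normc (e g) * normc (T g))) ^+ 2)).
    rewrite lerXn2r ?nnegrE ?normc_ge0 ?sumr_ge0//.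
      by move=> g _; rewrite !mulr_ge0 ?normc_ge0.
    apply: le_trans (le_normc_sum _ _ _) _; apply: ler_sum => g _.
    by rewrite !normcM mult_normc.
  apply: le_trans (weighted_cauchy_schwarz _ _ _ _) _ => //.
  by rewrite ler_wpM2l//; exact: kernel_bessel.
- move=> HP nP; split=> //.
  by rewrite -(sqr_sqrtr Q0) lerXn2r ?nnegrE ?nrm_ge0 ?sqrtr_ge0.
Qed.

Lemma polyz_mem A (e : multi_index -> C) : Hfun (polyz A e).
Proof. by have [] := polyz_norm A e. Qed.

Lemma monz_mem g : Hfun (monz g).
Proof.
have := polyz_mem [fset g]%fset (fun=> (mult g)%:R^-1).
suff -> : polyz [fset g]%fset (fun=> (mult g)%:R^-1) = monz g by [].
by apply/funext => z; rewrite /polyz big_seq_fset1 mulVKf// mult_neq0.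
Qed.

Lemma polyzE A (e : multi_index -> C) :
  polyz A e = \sum_(g <- A) ((mult g)%:R * e g) *: monz g.
Proof.
apply/funext => z; rewrite fct_sumE; apply: eq_bigr => g _.
exact: mulrA.
Qed.

Lemma ip_polyz (F : X -> C) A (e : multi_index -> C) : Hfun F ->
  ip F (polyz A e) = \sum_(g <- A) (mult g)%:R * (conjc (e g) * ip F (monz g)).
Proof.
move=> HF; rewrite polyzE ip_sumr//; last first.
  by move=> g; apply: rkhs_memZ; exact: monz_mem.
apply: eq_bigr => g _; rewrite ipZr//; last exact: monz_mem.
by rewrite conjcM conjc_nat mulrA.
Qed.

(** Division by zero gives [phase 0 = 0], so the modulus is 1 or 0. *)
Definition phase (c : C) : C := c / (normc c)%:C.

Lemma phaseJ c : conjc (phase c) * c = (normc c)%:C.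
Proof.
have [->|c0] := eqVneq c 0; first by rewrite mulr0 normc0.
have nc : (normc c)%:C != 0 :> C by rewrite -normCE normr_eq0.
have -> : conjc (phase c) = conjc c / (normc c)%:C.
  by rewrite /phase conjcM conjc_inv conjc_real.
rewrite mulrAC [conjc c * _]mulrC mulcJ realcX expr2.
by rewrite mulfK.
Qed.

Lemma normc_phase c : normc (phase c) <= 1.
Proof.
rewrite /phase normcM normcV normc_real ger0_norm ?normc_ge0//.
have [->|c0] := eqVneq (normc c) 0; first by rewrite mul0r.
by rewrite mulfV.
Qed.

Lemma mon_sq_le z A :
  \sum_(g <- A) (mult g)%:R * normc (mon (val z) g) ^+ 2 <=
  nrm (da_kernel R J ^~ z) ^+ 2.
Proof.
have := kernel_bessel [:: (1, z)] A.
have -> : kcomb (da_kernel R J) [:: (1, z)] = da_kernel R J ^~ z.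
  by rewrite /kcomb big_seq1 scale1r.
apply: le_trans; apply: ler_sum => g _.
by rewrite big_seq1 conjc1 mul1r.
Qed.

(** Pairing a function with a polynomial whose coefficients carry the right
    phases produces the sum of the moduli of the terms of its expansion. *)
Lemma majorant_as_ip (F : X -> C) z A : Hfun F ->
  ip F (polyz A (fun g => (normc (mon (val z) g))%:C * phase (ip F (monz g)))) =
  (\sum_(g <- A) normc ((mult g)%:R * ip F (monz g) * mon (val z) g))%:C.
Proof.
move=> HF; rewrite ip_polyz// realc_sum; apply: eq_bigr => g _.
rewrite conjcM conjc_real -mulrA phaseJ !normcM mult_normc !realcM realc_nat.
by rewrite -mulrA [X in _ * X]mulrC.
Qed.

Lemma phase_coef_norm (F : X -> C) z A :
  \sum_(g <- A) (mult g)%:R *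
    normc ((normc (mon (val z) g))%:C * phase (ip F (monz g))) ^+ 2 <=
  \sum_(g <- A) (mult g)%:R * normc (mon (val z) g) ^+ 2.
Proof.
apply: ler_sum => g _; rewrite ler_wpM2l// lerXn2r ?nnegrE ?normc_ge0//.
rewrite normcM normc_real ger0_norm ?normc_ge0//.
by rewrite ler_piMr ?normc_ge0 ?normc_phase.
Qed.

(** The polynomials [sA] truncating the kernel at [z] converge to it in norm, and [<F, sA>] is the
    partial sum of the expansion at [z]. *)
Lemma rkhs_expansion (F : X -> C) : Hfun F ->
  expansion F (fun g => (mult g)%:R * ip F (monz g)).
Proof.
move=> HF z; have Hk := rkhs_kernel H z; split.
  apply: (@abs_bounded_summable _ _ _ (nrm F * nrm (da_kernel R J ^~ z))) => A.
  set S := \sum_(g <- A) _.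
  have S0 : 0 <= S by apply: sumr_ge0 => g _; exact: normc_ge0.
  have := majorant_as_ip z A HF; set p := polyz _ _.
  move=> /(congr1 (@normc R)); rewrite normc_real -/S ger0_norm// => <-.
  have [Hp np] := polyz_norm A (fun g => (normc (mon (val z) g))%:C * phase (ip F (monz g))).
  apply: le_trans (cauchy_schwarz HF Hp) _; rewrite ler_wpM2l ?nrm_ge0//.
  rewrite -(@ler_pXn2r _ 2) ?nnegrE ?nrm_ge0//.
  apply: le_trans np _; apply: le_trans (phase_coef_norm _ _ _) _.
  exact: mon_sq_le.
apply/esym/has_csum_csum => e e0.
have nF1 : 0 < nrm F + 1 by rewrite ltr_wpDl ?nrm_ge0.
have d0 : 0 < (e / (nrm F + 1)) ^+ 2 by rewrite exprn_gt0// divr_gt0.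
have [A0 HA0] := has_csum_kernel z z d0.
exists A0 => A /HA0; rewrite -[X in _ - X](rkhs_reproducing z Hk).
set q := \sum_(g <- A) (mult g)%:R * normc (mon (val z) g) ^+ 2.
have -> : \sum_(g <- A) (mult g)%:R * (mon (val z) g * conjc (mon (val z) g)) = q%:C.
  by rewrite realc_sum; apply: eq_bigr => g _; rewrite mulcJ [RHS]realcM realc_nat.
rewrite ipff// -rmorphB normc_real distrC.
move=> /(le_lt_trans (ler_norm _)) qe.
pose sA := polyz A (fun g => conjc (mon (val z) g)).
have [HsA nsA] := polyz_norm A (fun g => conjc (mon (val z) g)).
rewrite -/sA in HsA nsA.
have nsA' : nrm sA ^+ 2 <= q.
  apply: le_trans nsA _; apply: ler_sum => g _; by rewrite normc_conj.
have sAz : ip (da_kernel R J ^~ z) sA = q%:C.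
  rewrite -ip_conj// rkhs_reproducing// /sA /polyz.
  have -> : \sum_(g <- A) (mult g)%:R * (conjc (mon (val z) g) * mon (val z) g) = q%:C.
    rewrite realc_sum; apply: eq_bigr => g _.
    by rewrite [conjc _ * _]mulrC mulcJ [RHS]realcM realc_nat.
  exact: conjc_real.
have -> : \sum_(g <- A) (mult g)%:R * ip F (monz g) * monomial (val z) g = ip F sA.
  rewrite ip_polyz//; apply: eq_bigr => g _.
  by rewrite conjcK -mulrA; congr (_ * _); exact: mulrC.
rewrite -(rkhs_reproducing z HF) -ipBr//.
apply: le_lt_trans (cauchy_schwarz HF (rkhs_memB HsA Hk)) _.
(* Since [|sA| ^ 2 <= q] and [<k_z, sA> = q], the squared distance is at most [|k_z| ^ 2 - q]. *)
have n2 : nrm (sA - da_kernel R J ^~ z) < e / (nrm F + 1).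
  rewrite -(@ltr_pXn2r _ 2) ?nnegrE ?nrm_ge0 ?(ltW (divr_gt0 _ _))//.
  rewrite nrmB// nrmB_sq// sAz /=; lra.
apply: (@le_lt_trans _ _ ((nrm F + 1) * nrm (sA - da_kernel R J ^~ z))).
  by rewrite ler_wpM2r ?nrm_ge0// lerDl.
by rewrite mulrC -ltr_pdivlMr.
Qed.

End DruryArveson.

(** * Points of norm at most 1/3 *)

Section BohrInner.
Variables (R : realType) (J : choiceType) (H : drury_arveson R J).
Local Notation multi_index := {fsfun J -> nat with 0%N}.
Local Notation X := (l2ball R J).
Local Notation Hfun := (rkhs_fun H).
Local Notation ip := (rkhs_ip H).
Local Notation nrm := (rkhs_norm H).
Local Notation C := R[i].
Local Notation monz := (@monz R J).
Implicit Types (g h : multi_index) (A : {fset multi_index}) (z : X).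

Definition mi0 : multi_index := [fsfun].

Lemma mon0 (K : comNzRingType) (x : J -> K) : mon x mi0 = 1.
Proof. by rewrite /mon finsupp0 big_seq_fset0. Qed.

Lemma deg_eq0 g : (deg g == 0%N) = (g == mi0).
Proof.
apply/eqP/eqP => [g0|->]; last by rewrite /deg finsupp0 big_seq_fset0.
apply/fsfunP => j; rewrite fsfun0E; apply/eqP; have := le_deg g j.
by rewrite g0 leqn0.
Qed.

Lemma mult0 : mult mi0 = 1%N.
Proof. by rewrite /mult /word finsupp0. Qed.

Lemma l2ball_origin : exists z : X, val z = (fun=> 0).
Proof.
have [z zE] := @curve_ball R J fset0 0 0 (lexx _) ler01.
by exists z; rewrite zE; apply/funext => j; rewrite /curve inE.
Qed.

(** Makes evaluation at the origin a pairing with the constant function 1. *)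
Lemma kernel0 z0 : val z0 = (fun=> 0) -> da_kernel R J ^~ z0 = monz mi0.
Proof.
move=> z0E; apply/funext => z; rewrite /da_kernel /monz mon0 z0E /inner.
have -> : csum (fun j => \val z j * conjc 0) = 0.
  apply: has_csum_csum; apply: eq_has_csum (@has_csum0 R J) => j.
  by rewrite conjc0 mulr0.
by rewrite subr0 divr1.
Qed.

Lemma mon_origin z0 g : val z0 = (fun=> 0) -> (0 < deg g)%N ->
  mon (val z0 : J -> C) g = 0.
Proof.
move=> -> g0; have [j jg] : exists j, j \in finsupp g.
  apply/fset0Pn; apply: contraTneq g0 => gE.
  by rewrite /deg gE big_seq_fset0.
exact: mon_eq0 jg _.
Qed.

(** * Estimates for a bounded multiplier *)

Section Multiplier.
Variables (Phi : X -> C) (c : R) (z0 : X).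
Hypothesis z0E : val z0 = (fun=> 0).
(** [c] is any bound of the multiplication rather than its norm, which leaves room for the strict
    inequality [normc (Phi z0) < c]. *)
Hypothesis PhiH : forall f, Hfun f -> Hfun (Phi \* f) /\ nrm (Phi \* f) <= c * nrm f.

Let one : X -> C := monz mi0.
Let Hone : Hfun one. Proof. exact: monz_mem. Qed.

Let ip_one f : Hfun f -> ip f one = f z0.
Proof. by move=> Hf; rewrite /one -(kernel0 z0E) rkhs_reproducing. Qed.

Let one_val z : one z = 1. Proof. exact: mon0. Qed.

Let nrm_one : nrm one = 1.
Proof.
apply: (@pexpIrn _ 2); rewrite ?nnegrE ?nrm_ge0//.
by rewrite nrm_sq// ip_one// one_val expr1n.
Qed.

Let Phi1 : Phi \* one = Phi.
Proof. by apply/funext => z /=; rewrite one_val mulr1. Qed.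

Lemma multiplier_mem : Hfun Phi.
Proof. by rewrite -Phi1; exact: (PhiH Hone).1. Qed.
Local Notation HPhi := multiplier_mem.

Lemma multiplier_origin_le : normc (Phi z0) <= c.
Proof.
rewrite -(ip_one HPhi); apply: le_trans (cauchy_schwarz HPhi Hone) _.
by rewrite nrm_one mulr1 -[X in nrm X]Phi1 (le_trans (PhiH Hone).2)// nrm_one mulr1.
Qed.

(** [Phi * p - Phi(0) * p] vanishes at the origin to order more than [n], hence
    is orthogonal to the polynomials of degree [n]. *)
Lemma ip_mult_homogeneous n A (e : multi_index -> C) :
  (forall g, g \in A -> deg g = n) ->
  ip (Phi \* polyz A e) (polyz A e) = Phi z0 * (nrm (polyz A e) ^+ 2)%:C.
Proof.
move=> An; set p := polyz A e; have Hp : Hfun p := polyz_mem H A e.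
have HPp := (PhiH Hp).1.
pose G := Phi \* p - Phi z0 *: p.
have HG : Hfun G by apply: rkhs_memB => //; exact: rkhs_memZ.
have [S [m AS]] := sub_box A.
have AS' : {subset A <= box S n}.
  move=> g gA; rewrite mem_box An// leqnn /=.
  by move: (fsubsetP AS _ gA); rewrite mem_box => /andP[].
pose a g := (mult g)%:R * ip Phi (monz g).
have Phia : expansion Phi a := rkhs_expansion HPhi.
have [z1 z1E] := @curve_ball R J S n 1 ler01 (lexx _).
have [_ [B HB]] := expansion_has_csum z1 Phia.
pose K := \sum_(g <- A) (mult g)%:R * (normc (e g) * normc (mon (val z1) g)).
have a0E : a mi0 = Phi z0 by rewrite /a mult0 mul1r ip_one//; exact: HPhi.
have van : forall g, g \in box S n -> (mult g)%:R * ip G (monz g) = 0.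
  (* Along the curve, [Phi - Phi z0] is of order [t ^ M] and [p] of order [t ^ (M * n)]; the product
     reaches exactly the exponent [n.+1 * M] required. *)
  apply: (expansion_vanish (K := B * K) (rkhs_expansion HG)) => t z t0 t1 zE.
  set M := degree_weight S n.
  have small g : normc (mon (val z) g) <= t ^+ (M * deg g) * normc (mon (val z1) g).
    by rewrite zE z1E; apply: curve_le => //; exact: ltW.
  have tM k : 0 <= t ^+ k by rewrite exprn_ge0// ltW.
  have pz : normc (p z) <= t ^+ (M * n) * K.
    apply: le_trans (le_normc_sum _ _ _) _; rewrite /K mulr_sumr.
    rewrite big_seq [leRHS]big_seq; apply: ler_sum => g gA.
    rewrite !normcM mult_normc [leRHS]mulrCA ler_wpM2l ?ler0n// [leRHS]mulrCA ler_wpM2l ?normc_ge0//.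
    by rewrite -(An g gA).
  have Phiz : normc (Phi z - Phi z0) <= t ^+ M * B.
    have [zs _] := expansion_has_csum z Phia.
    apply: (has_csum_le (A1 := [fset mi0]%fset) zs) => D.
    rewrite fsub1set => D0; rewrite (big_fsetD1 mi0)//= mon0 mulr1 a0E addrC addrK.
    apply: le_trans (le_normc_sum _ _ _) _.
    apply: le_trans (ler_wpM2l (tM M) (HB (D `\ mi0)%fset)).
    rewrite mulr_sumr big_seq [leRHS]big_seq; apply: ler_sum => g.
    rewrite !inE => /andP[g0 _].
    rewrite !normcM mulrCA ler_wpM2l ?mulr_ge0 ?normc_ge0//.
    apply: le_trans (small g) _; rewrite ler_wpM2r ?normc_ge0//.
    by rewrite ler_wiXn2l ?(ltW t0)// leq_pmulr// lt0n deg_eq0.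
  have -> : G z = (Phi z - Phi z0) * p z by rewrite mulrBl.
  rewrite normcM; apply: le_trans (ler_pM (normc_ge0 _) (normc_ge0 _) Phiz pz) _.
  rewrite mulrACA -exprD mulrC (_ : (n.+1 * M = M + M * n)%N)//.
  by rewrite mulSn mulnC.
have : ip G p = 0.
  rewrite ip_polyz// big_seq big1// => g /AS' /van.
  by rewrite mulrCA => ->; rewrite mulr0.
rewrite /G ipBl ?ipZl ?ipff//; last exact: rkhs_memZ.
by move=> /eqP; rewrite subr_eq0 => /eqP.
Qed.

(** [s], [a], [q] stand for [<Phi, p>], [|Phi z0|], [|p| ^ 2]; the hypothesis is the compressed
    operator bound tested on [1] plus a multiple of [p] of modulus at most [|t|]. *)
Lemma real_quadratic_bound (s a q : R) : 0 <= s -> 0 <= a -> 0 < q -> a < c ->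
  (forall t : R, a ^+ 2 * q + (s + t * a * q) ^+ 2 <= c ^+ 2 * (1 + t ^+ 2 * q) * q) ->
  s * c <= Num.sqrt q * (c ^+ 2 - a ^+ 2).
Proof.
move=> s0 a0 q0 ac st.
have c0 : 0 < c by exact: le_lt_trans ac.
have D0 : 0 < c ^+ 2 - a ^+ 2 by rewrite subr_gt0 ltrXn2r// ?nnegrE ?(ltW c0).
set D := c ^+ 2 - a ^+ 2 in D0 *.
rewrite -(@ler_pXn2r _ 2) ?nnegrE ?mulr_ge0 ?sqrtr_ge0 ?(ltW c0) ?(ltW D0)//.
rewrite !exprMn sqr_sqrtr ?(ltW q0)//.
(* The critical point in [t] of the difference of the two sides, which is concave because
   [a < c]. *)
have := st (s * a / (D * q)).
have E1 : s + s * a / (D * q) * a * q = s * c ^+ 2 / D.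
  have -> : c ^+ 2 = D + a ^+ 2 by rewrite /D subrK.
  by field; rewrite !gt_eqF.
have E2 : c ^+ 2 * (1 + (s * a / (D * q)) ^+ 2 * q) * q =
    c ^+ 2 * q + c ^+ 2 * s ^+ 2 * a ^+ 2 / D ^+ 2.
  by field; rewrite !gt_eqF.
rewrite E1 E2 => st'.
have : (s * c ^+ 2 / D) ^+ 2 - c ^+ 2 * s ^+ 2 * a ^+ 2 / D ^+ 2 <= D * q.
  by rewrite {3}/D; lra.
have -> : (s * c ^+ 2 / D) ^+ 2 - c ^+ 2 * s ^+ 2 * a ^+ 2 / D ^+ 2 =
    s ^+ 2 * c ^+ 2 * (c ^+ 2 - a ^+ 2) / D ^+ 2 by field; rewrite gt_eqF.
rewrite -/D ler_pdivrMr ?exprn_gt0// => Hs.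
rewrite -(ler_pM2r D0); apply: le_trans Hs _.
by rewrite le_eqVlt; apply/orP; left; apply/eqP; ring.
Qed.

(** Compressing multiplication by [Phi] to the span of [1] and a homogeneous
    polynomial [p] gives a lower triangular two by two matrix with [Phi(0)] on the
    diagonal; its off-diagonal entry is controlled by its norm. *)
Lemma homogeneous_bound n A z : (0 < n)%N -> normc (Phi z0) < c ->
  (forall g, g \in A -> deg g = n) ->
  (\sum_(g <- A) normc ((mult g)%:R * ip Phi (monz g) * mon (val z) g)) * c <=
  l2norm (val z) ^+ n * (c ^+ 2 - normc (Phi z0) ^+ 2).
Proof.
move=> n0 ac An.
pose e g := (normc (mon (val z) g))%:C * phase (ip Phi (monz g)).
set s := \sum_(g <- A) _.
have s0 : 0 <= s by apply: sumr_ge0 => g _; exact: normc_ge0.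
have := majorant_as_ip z A HPhi; rewrite -/s -/e => sE.
have := ip_mult_homogeneous e An.
have [] := polyz_norm H A e; set p := polyz A e in sE *.
move=> Hp np PhipE; set q := nrm p ^+ 2 in np PhipE.
set a := normc (Phi z0) in ac *.
have a0 : 0 <= a by exact: normc_ge0.
have c0 : 0 < c by exact: le_lt_trans ac.
have D0 : 0 <= c ^+ 2 - a ^+ 2 by rewrite subr_ge0 lerXn2r ?nnegrE ?(ltW ac)// ltW.
(* The multinomial theorem in the variables [|z_j| ^ 2], restricted to degree [n]. *)
have qn : Num.sqrt q <= l2norm (val z) ^+ n.
  rewrite -(@ler_pXn2r _ 2) ?nnegrE ?sqrtr_ge0 ?exprn_ge0 ?sqrtr_ge0//.
  rewrite sqr_sqrtr ?sqr_ge0//.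
  apply: le_trans np _; apply: le_trans (phase_coef_norm _ _ _ _) _.
  rewrite -exprM mulnC exprM.
  rewrite (eq_bigr (fun g => (mult g)%:R * mon (fun j => normc (val z j) ^+ 2) g)); last first.
    by move=> g _; rewrite normc_mon expr2 -monM.
  apply: sum_layer_le => //; first by move=> j; exact: sqr_ge0.
  by move=> S; apply: sum_sq_le; exact: ball_fin.
suff : s * c <= Num.sqrt q * (c ^+ 2 - a ^+ 2).
  by move=> /le_trans; apply; rewrite ler_wpM2r.
have p0 : p z0 = 0.
  rewrite /p /polyz big_seq big1// => g gA.
  by rewrite mon_origin ?mulr0// An.
have [q0|q0] := eqVneq q 0.
  have : s <= 0.
    have /(congr1 (@normc R)) := sE; rewrite normc_real ger0_norm// => <-.
    apply: le_trans (cauchy_schwarz HPhi Hp) _.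
    by move/eqP: q0; rewrite sqrf_eq0 => /eqP ->; rewrite mulr0.
  move=> s0'; have -> : s = 0 by apply/le_anti; rewrite s0 s0'.
  by rewrite mul0r mulr_ge0 ?sqrtr_ge0.
have qp : 0 < q by rewrite lt_neqAle eq_sym q0 sqr_ge0.
apply: real_quadratic_bound => // t.
(* This phase makes [b * Phi z0 = t * a] real, so that it adds to the real number [s] without
   cancellation. *)
pose b : C := t%:C * conjc (phase (Phi z0)).
have Hbp : Hfun (b *: p) by exact: rkhs_memZ.
have Hf := rkhs_memD Hone Hbp.
have [HPf nPf] := PhiH Hf.
have nf : nrm (one + b *: p) ^+ 2 <= 1 + t ^+ 2 * q.
  rewrite nrmD_sq// nrm_one expr1n -[ip one _]conjcK ip_conj// ipZl// ip_one//.
  rewrite p0 mulr0 conjc0 /= mulr0 addr0 lerD2l nrmZ// exprMn -/q ler_wpM2r ?sqr_ge0//.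
  rewrite /b normcM normc_real normc_conj exprMn real_normK ?num_real//.
  by rewrite ler_piMr ?sqr_ge0// exprn_ile1 ?normc_ge0 ?normc_phase.
have PfE : Phi \* (one + b *: p) = Phi + b *: (Phi \* p).
  apply/funext => x; rewrite !fctE /= mulrDr one_val mulr1.
  by congr (_ + _); exact: mulrCA.
set y := s + t * a * q.
have ip1 : ip (Phi \* (one + b *: p)) one = Phi z0.
  by rewrite ip_one//= !fctE /= p0 scaler0 addr0 one_val mulr1.
have [HPp _] := PhiH Hp.
have ip2 : ip (Phi \* (one + b *: p)) p = y%:C.
  rewrite PfE ipDl//; [|exact: HPhi|exact: rkhs_memZ].
  rewrite sE ipZl// PhipE /b -!mulrA [conjc _ * _]mulrA phaseJ.
  by rewrite /y rmorphD /= -!realcM mulrA.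
set f := Phi \* _ in HPf nPf ip1 ip2.
(* The orthogonal projection of [f] onto the span of [one] and [p], which are orthogonal since
   [p z0 = 0]; [Bq] is its squared norm. *)
pose w := Phi z0 *: one + (y / q)%:C *: p.
have Hw : Hfun w by apply: rkhs_memD; exact: rkhs_memZ.
pose Bq := a ^+ 2 + y ^+ 2 / q.
have Bq0 : 0 <= Bq by rewrite addr_ge0 ?sqr_ge0// divr_ge0 ?sqr_ge0// ltW.
have fw : ip f w = Bq%:C.
  rewrite ipDr//; try exact: rkhs_memZ.
  rewrite !ipZr// ip1 ip2 conjc_real mulrC mulcJ -realcM.
  by rewrite -rmorphD /Bq expr2 mulrAC.
have nw : nrm w ^+ 2 = Bq.
  rewrite nrmD_sq//; try exact: rkhs_memZ.
  rewrite !nrmZ// nrm_one mulr1 normc_real exprMn -/q real_normK ?num_real//.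
  rewrite -[ip _ (_ *: p)]conjcK ip_conj//; try exact: rkhs_memZ.
  rewrite ipZl//; last exact: rkhs_memZ.
  rewrite ipZr// ip_one// p0 !mulr0 addr0 -/a /Bq; congr (_ + _).
  by field.
have Bf : Bq <= nrm f ^+ 2.
  have [->|Bn] := eqVneq Bq 0; first exact: sqr_ge0.
  have Bp : 0 < Bq by rewrite lt_neqAle eq_sym Bn.
  have := cauchy_schwarz HPf Hw; rewrite fw normc_real ger0_norm// => fwB.
  rewrite -(ler_pM2r Bp) -{3}nw -exprMn -expr2 lerXn2r// nnegrE//.
  by rewrite mulr_ge0 ?nrm_ge0.
have : Bq <= c ^+ 2 * (1 + t ^+ 2 * q).
  apply: le_trans Bf _; apply: (@le_trans _ _ ((c * nrm (one + b *: p)) ^+ 2)).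
    by rewrite lerXn2r ?nnegrE ?nrm_ge0// mulr_ge0 ?nrm_ge0// ltW.
  by rewrite exprMn ler_wpM2l ?sqr_ge0.
rewrite -(ler_pM2r qp); apply: le_trans.
rewrite /Bq /y le_eqVlt; apply/orP; left; apply/eqP; by field.
Qed.

Lemma majorant_bound z A : normc (Phi z0) < c -> l2norm (val z) <= 1 / 3 ->
  \sum_(g <- A) normc ((mult g)%:R * ip Phi (monz g) * mon (val z) g) <= c.
Proof.
move=> ac z3; set a := normc (Phi z0) in ac *.
have a0 : 0 <= a by exact: normc_ge0.
have c0 : 0 < c by exact: le_lt_trans ac.
have D0 : 0 <= c ^+ 2 - a ^+ 2 by rewrite subr_ge0 lerXn2r ?nnegrE ?(ltW ac)// ltW.
have [S [n AS]] := sub_box A.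
pose F g := normc ((mult g)%:R * ip Phi (monz g) * mon (val z) g).
have F0 g : 0 <= F g by exact: normc_ge0.
apply: (@le_trans _ _ (\sum_(g <- box S n) F g)).
  exact: fset_sum_le.
rewrite sum_box big_ord_recl /=.
have -> : \sum_(g <- layer S 0) F g = a.
  have -> : layer S 0 = [fset mi0]%fset.
    apply/fsetP => g; rewrite mem_layer deg_eq0 !inE.
    by case: eqP => // ->; rewrite finsupp0 fsub0set.
  by rewrite big_seq_fset1 /F mon0 mulr1 mult0 mul1r ip_one//; exact: HPhi.
(* [bump 0 k] is [k.+1]: the layer of degree 0 has been split off, and [homogeneous_bound] needs
   positive degree. *)
have step (k : 'I_n) : \sum_(g <- layer S (bump 0 k)) F g <=
    (c ^+ 2 - a ^+ 2) / c * 3^-1 * 3^-1 ^+ k.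
  rewrite -mulrA -exprS mulrAC ler_pdivlMr//.
  apply: (@le_trans _ _ (l2norm (val z) ^+ k.+1 * (c ^+ 2 - a ^+ 2))).
    apply: homogeneous_bound => // g.
    by rewrite mem_layer => /andP[/eqP].
  rewrite mulrC ler_wpM2l// lerXn2r ?nnegrE ?sqrtr_ge0 ?invr_ge0//.
  by rewrite -[3^-1]mul1r.
apply: le_trans (lerD (lexx a) (ler_sum _ (fun k _ => step k))) _.
rewrite -mulr_sumr.
have g3 : \sum_(k < n) (3^-1 : R) ^+ k <= 3 / 2.
  have -> : (3 / 2 : R) = (1 - 3^-1)^-1 by field.
  by apply: geometric_sum_le; rewrite ?invr_ge0// invf_lt1// ltr1n.
have Dc : 0 <= (c ^+ 2 - a ^+ 2) / c * 3^-1 by rewrite !mulr_ge0 ?invr_ge0// ltW.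
apply: le_trans (lerD (lexx a) (ler_wpM2l Dc g3)) _.
have -> : (c ^+ 2 - a ^+ 2) / c * 3^-1 * (3 / 2) = (c ^+ 2 - a ^+ 2) / (2 * c).
  by field; rewrite gt_eqF.
(* [(c - a) * (c + a) <= (c - a) * (2 * c)], because [a < c]. *)
rewrite -lerBrDl ler_pdivrMr ?mulr_gt0//; nra.
Qed.

End Multiplier.

Lemma bohr_set_ge (z : X) : l2norm (val z) <= 1 / 3 -> bohr_set H z.
Proof.
move=> z3 Phi mP; have [z0 z0E] := l2ball_origin.
have PH c : mult_norm H Phi <= c -> forall f, Hfun f ->
    Hfun (Phi \* f) /\ nrm (Phi \* f) <= c * nrm f.
  move=> cP f Hf; split; first exact: mP.1.
  by apply: le_trans (mult_norm_le mP Hf) _; rewrite ler_wpM2r ?nrm_ge0.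
have HP := multiplier_mem (PH _ (lexx _)).
rewrite /majorant (coefs_eq (rkhs_expansion HP)).
apply/esum_EFin_le => A; apply/ler_addgt0Pr => e e0.
(* For constants [|Phi z0|] equals the multiplier norm, where the quadratic estimate degenerates;
   the slack [e] keeps the inequality strict. *)
have cP : mult_norm H Phi <= mult_norm H Phi + e by rewrite lerDl ltW.
apply: (majorant_bound z0E (PH _ cP)) => //.
apply: le_lt_trans (multiplier_origin_le z0E (PH _ (lexx _))) _.
by rewrite ltrDl.
Qed.

End BohrInner.

(** * Points of norm more than 1/3 *)

Section BohrOuter.
Variables (R : realType) (J : choiceType) (H : drury_arveson R J).
Local Notation multi_index := {fsfun J -> nat with 0%N}.
Local Notation X := (l2ball R J).
Local Notation Hfun := (rkhs_fun H).
Local Notation ip := (rkhs_ip H).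
Local Notation nrm := (rkhs_norm H).
Local Notation C := R[i].
Local Notation monz := (@monz R J).
Local Notation k := (da_kernel R J).
Implicit Types (g h : multi_index) (A : {fset multi_index}) (x y z : X).

Lemma has_csum_sq (z : J -> C) : (l2sum z < +oo)%E ->
  has_csum (fun j => z j * conjc (z j)) (l2norm z ^+ 2)%:C.
Proof.
move=> zoo.
have [s zs] := @has_csum_nneg R J (fun j => normc (z j) ^+ 2) _
  (fun j => sqr_ge0 _) (fun S => sum_sq_le S zoo).
suff <- : s = l2norm z ^+ 2 by apply: eq_has_csum zs => j; rewrite mulcJ.
have s0 : 0 <= s.
  apply: (has_csum_Re_ge (A1 := fset0) zs) => A _.
  by rewrite Re_sum sumr_ge0// => j _; exact: sqr_ge0.
apply/le_anti/andP; split.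
  rewrite -[s]ger0_norm// -normc_real; apply: has_csum_norm_le zs _ => A.
  apply: le_trans (sum_sq_le A zoo); apply: ler_sum => j _.
  by rewrite normc_real ger0_norm ?sqr_ge0.
rewrite -lee_fin -l2sum_fin//; apply/esum_EFin_le => A.
by apply: has_csum_ge_partial zs => j; exact: sqr_ge0.
Qed.

(** * Moebius functions as contractive multipliers *)

Section Moebius.
Variables (a : R) (u : J -> C) (v : X).
Hypothesis a01 : 0 < a < 1.
Hypothesis uoo : (l2sum u < +oo)%E.
Hypothesis u1 : l2norm u = 1.
Hypothesis vE : val v = (fun j => a%:C * u j).

Let tau (z : X) : C := inner (val z) u.

Definition moebius (z : X) : C := (a%:C - tau z) / (1 - a%:C * tau z).

Let inner_v z : inner (val z) (val v) = a%:C * tau z.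
Proof.
apply: has_csum_csum.
have := has_csumZ a%:C (has_csum_inner (ball_fin z) uoo).
by apply: eq_has_csum => j; rewrite vE conjcM conjc_real mulrCA.
Qed.

Let one_sub_neq0 (c : C) : normc c < 1 -> 1 - c != 0.
Proof. by move=> c1; rewrite subr_eq0; apply: contraTneq c1 => <-; rewrite normc1 ltxx. Qed.

Let den_neq0 z : 1 - a%:C * tau z != 0.
Proof. by rewrite -inner_v one_sub_neq0// inner_lt1. Qed.

(** Partial fractions: as a combination of 1 and the kernel at [v], the function lies in [H] and its
    coefficients follow by the reproducing property. *)
Lemma moebiusE z : moebius z = a%:C^-1 + (a%:C - a%:C^-1) * k z v.
Proof.
have a0 : a%:C != 0 :> C.
  by rewrite fmorph_eq0 gt_eqF//; case/andP: a01.
have d := den_neq0 z.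
rewrite /moebius /da_kernel inner_v; field.
by rewrite a0 d.
Qed.

Let rest z (j : J) : C := val z j - tau z * u j.

Let has_csum_rest x y :
  has_csum (fun j => rest x j * conjc (rest y j))
    (inner (val x) (val y) - tau x * conjc (tau y)).
Proof.
have H1 := has_csum_inner (ball_fin x) (ball_fin y).
have H2 := has_csumZ (- conjc (tau y)) (has_csum_inner (ball_fin x) uoo).
have H3 := has_csumZ (- tau x) (has_csum_conj (has_csum_inner (ball_fin y) uoo)).
have := has_csumZ (tau x * conjc (tau y)) (has_csum_sq uoo).
rewrite u1 expr1n => H4.
have := has_csumD (has_csumD H1 H2) (has_csumD H3 H4).
have -> : inner (val x) (val y) + - conjc (tau y) * inner (val x) u +
    (- tau x * conjc (inner (val y) u) + tau x * conjc (tau y) * 1%:C) =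
    inner (val x) (val y) - tau x * conjc (tau y).
  by rewrite -/(tau x) -/(tau y); ring.
apply: eq_has_csum => j; rewrite /rest conjcB !conjcM conjcK; ring.
Qed.

(** The positivity of [(1 - moebius x * conjc (moebius y)) * k x y]: up to a
    congruence it is [1 + (<x, y> - tau x * conjc (tau y)) * k x y], and
    [<x, y> - tau x * conjc (tau y)] is the inner product of the components of
    [x] and [y] orthogonal to [u]. *)
Lemma moebius_contraction (s : seq (C * X)) :
  nrm (kcomb k [seq (p.1 * conjc (moebius p.2), p.2) | p <- s]) <=
  1 * nrm (kcomb k s).
Proof.
rewrite mul1r -(@ler_pXn2r _ 2) ?nnegrE ?nrm_ge0// -subr_ge0.
pose d z := (1 - a%:C * tau z)^-1.
pose T : C := \sum_(p <- s) conjc p.1 * d p.2.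
pose Q : C := \sum_(p <- s) \sum_(q <- s)
  conjc p.1 * d p.2 * (q.1 * conjc (d q.2)) * k p.2 q.2 *
  (inner (val p.2) (val q.2) - tau p.2 * conjc (tau q.2)).
have Q0 : 0 <= Re Q.
  have cs := has_csum_sum s (fun p => has_csum_sum s (fun q =>
    has_csumZ (conjc p.1 * d p.2 * (q.1 * conjc (d q.2)) * k p.2 q.2)
      (has_csum_rest p.2 q.2))).
  apply: (has_csum_Re_ge (A1 := fset0) cs) => A _.
  rewrite Re_sum; apply: sumr_ge0 => j _.
  (* For fixed [j] the term is the squared norm of a kernel combination whose weights absorb [rest],
     an instance of Schur's product theorem. *)
  pose sj := [seq (p.1 * conjc (d p.2) * conjc (rest p.2 j), p.2) | p <- s].
  have <- : (nrm (kcomb k sj) ^+ 2)%:C = \sum_(p <- s) \sum_(q <- s)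
      conjc p.1 * d p.2 * (q.1 * conjc (d q.2)) * k p.2 q.2 *
      (rest p.2 j * conjc (rest q.2 j)).
    rewrite kcomb_norm_sq big_map; apply: eq_bigr => p _.
    rewrite big_map; apply: eq_bigr => q _ /=.
    by rewrite !conjcM !conjcK; ring.
  exact: sqr_ge0.
suff E : nrm (kcomb k s) ^+ 2 -
    nrm (kcomb k [seq (p.1 * conjc (moebius p.2), p.2) | p <- s]) ^+ 2 =
    (1 - a ^+ 2) * (normc T ^+ 2 + Re Q).
  rewrite E; apply: mulr_ge0; last by rewrite addr_ge0 ?sqr_ge0.
  by case/andP: a01 => a0 a1; rewrite subr_ge0 exprn_ile1// ltW.
(* Termwise this rests on [(1 - a * s) * (1 - a * t) - (a - s) * (a - t) = (1 - a ^ 2) * (1 - s *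
   t)] with [s = tau x] and [t = conjc (tau y)]. *)
have EC : ((nrm (kcomb k s) ^+ 2)%:C -
    (nrm (kcomb k [seq (p.1 * conjc (moebius p.2), p.2) | p <- s]) ^+ 2)%:C : C) =
    (1 - a ^+ 2)%:C * (T * conjc T + Q).
  rewrite !kcomb_norm_sq big_map.
  have -> : T * conjc T = \sum_(p <- s) \sum_(q <- s)
      conjc p.1 * d p.2 * (q.1 * conjc (d q.2)).
    rewrite /T conjc_sum mulr_suml; apply: eq_bigr => p _.
    by rewrite mulr_sumr; apply: eq_bigr => q _; rewrite conjcM conjcK.
  rewrite /Q -big_split -sumrB /= mulr_sumr; apply: eq_bigr => p _.
  rewrite big_map -big_split -sumrB /= mulr_sumr; apply: eq_bigr => q _ /=.
  have dp := den_neq0 p.2.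
  have dq : 1 - a%:C * conjc (tau q.2) != 0.
    have := den_neq0 q.2; apply: contra_neq => /(congr1 (@conjc R)).
    by rewrite conjcB conjcM conjcK conjc1 conjc0 conjc_real.
  have kd : 1 - inner (val p.2) (val q.2) != 0.
    by rewrite one_sub_neq0// inner_lt1.
  rewrite conjcM conjcK /moebius /d conjcM !conjc_inv !conjcB !conjcM conjc1 !conjc_real /da_kernel.
  have -> : (1 - a ^+ 2)%:C = 1 - a%:C ^+ 2 :> C by rewrite realcB realcX.
  field.
  by rewrite dp dq kd.
have /(congr1 (@complex.Re R)) := EC.
by rewrite ReD ReN mulcJ; case: Q {Q0 EC} => q1 q2 /= ->; ring.
Qed.

Lemma moebius_multiplier : multiplier H moebius /\ mult_norm H moebius <= 1.
Proof.
have B := multiplier_bound ler01 moebius_contraction.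
split.
  split=> [f /B[]//|]; exists 1 => f /B[_]; exact.
apply: ge_sup => [|_ [f [Hf f1] <-]].
  exists (nrm (moebius \* 0)); exists 0 => //; split; first exact: rkhs_0.
  by rewrite nrm0.
by have [_ /le_trans] := B f Hf; apply; rewrite mul1r.
Qed.

Lemma coefs_moebius g :
  coefs moebius g = if g == mi0 J then a%:C else
    (a%:C - a%:C^-1) * ((mult g)%:R * conjc (mon (val v) g)).
Proof.
have [z0 z0E] := @l2ball_origin R J.
have Hv := rkhs_kernel H v; have Hone := monz_mem H (mi0 J).
have E : moebius = a%:C^-1 *: monz (mi0 J) + (a%:C - a%:C^-1) *: (k ^~ v).
  apply/funext => z; rewrite moebiusE !fctE /monz mon0.
  by congr (_ + _); rewrite /GRing.scale /= mulr1.
have Hm : Hfun moebius.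
  by rewrite E; apply: rkhs_memD; exact: rkhs_memZ.
rewrite (coefs_eq (rkhs_expansion Hm)) E.
have Hg := monz_mem H g.
rewrite ipDl//; try exact: rkhs_memZ.
rewrite (ipZl _ Hone Hg) (ipZl _ Hv Hg) -[ip (k ^~ v) _]conjcK ip_conj// rkhs_reproducing//.
rewrite -(kernel0 z0E) -[ip (k ^~ z0) _]conjcK ip_conj ?rkhs_reproducing//; last exact: rkhs_kernel.
rewrite /monz; case: eqVneq => [->|g0].
  by rewrite !mon0 conjc1 !mulr1 mult0 mul1r addrC subrK.
rewrite (mon_origin z0E) ?lt0n ?deg_eq0// conjc0 mulr0 add0r.
by rewrite mulrCA.
Qed.

End Moebius.

Lemma bohr_set_le (z : X) : bohr_set H z -> l2norm (val z) <= 1 / 3.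
Proof.
move=> zB; rewrite leNgt; apply/negP => z3.
set r := l2norm (val z) in z3.
have r0 : 0 < r by lra.
have [zoo r1] := set_mem (valP z); rewrite -/r in r1.
(* The midpoint between [(r^-1 - 1) / 2], above which [r * (1 + 2 * a) > 1], and 1; the former is
   below 1 since [r > 1 / 3]. *)
pose a := ((r^-1 - 1) / 2 + 1) / 2.
have ri1 : 1 < r^-1 by rewrite invf_gt1.
have ri3 : r^-1 < 3 by rewrite invf_plt ?posrE//; lra.
have a0 : 0 < a by rewrite /a; lra.
have a1 : a < 1 by rewrite /a; lra.
have ar : 1 < r * (1 + 2 * a).
  have -> : r * (1 + 2 * a) = r * r^-1 / 2 + r * 3 / 2.
    by rewrite /a; field; rewrite gt_eqF.
  by rewrite mulfV ?gt_eqF//; lra.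
pose u (j : J) : C := (r^-1)%:C * val z j.
have usq S : \sum_(j <- S) normc (u j) ^+ 2 = r^-1 ^+ 2 * \sum_(j <- S) normc (val z j) ^+ 2.
  rewrite mulr_sumr; apply: eq_bigr => j _.
  by rewrite normcM normc_real exprMn real_normK ?num_real.
have [uoo u1'] : (l2sum u < +oo)%E /\ l2norm u <= 1.
  apply: sum_sq_l2norm => // S; rewrite usq expr1n exprVn mulrC ler_pdivrMr ?exprn_gt0//.
  by rewrite mul1r sum_sq_le.
have usum : has_csum (fun j => u j * conjc (u j)) 1.
  have := has_csumZ (r^-1 ^+ 2)%:C (has_csum_sq zoo).
  rewrite -realcM -/r -exprMn mulVf ?gt_eqF// expr1n.
  by apply: eq_has_csum => j; rewrite !mulcJ -realcM normcM normc_real exprMn real_normK ?num_real.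
have u1 : l2norm u = 1.
  have := has_csum_unique usum (has_csum_sq uoo) => -[/esym/eqP].
  by rewrite sqrf_eq1 => /orP[/eqP//|/eqP E]; have := sqrtr_ge0 (fine (l2sum u)); rewrite -/(l2norm u) E; lra.
pose w (j : J) : C := a%:C * u j.
have [v vE] : exists v : X, val v = w.
  have [voo v1] : (l2sum w < +oo)%E /\ l2norm w <= a.
    apply: sum_sq_l2norm => [|S]; first exact: ltW.
    rewrite (eq_bigr (fun j => a ^+ 2 * normc (u j) ^+ 2)); last first.
      by move=> j _; rewrite normcM normc_real exprMn real_normK ?num_real.
    rewrite -mulr_sumr ler_piMr ?sqr_ge0//.
    by apply: le_trans (sum_sq_le S uoo) _; rewrite u1 expr1n.
  have vb : l2ball R J w by split=> //; exact: le_lt_trans v1 a1.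
  by exists (exist (fun f : J -> C => f \in l2ball R J) _ (mem_set vb)).
have a01 : 0 < a < 1 by rewrite a0 a1.
have [mP m1] := moebius_multiplier a01 uoo u1 vE.
have maj : (majorant (moebius a u) z <= 1%:E)%E.
  by apply: le_trans (zB _ mP) _; rewrite lee_fin.
move/esum_EFin_le : maj => maj.
pose f g := (mult g)%:R * (mon (val z) g * conjc (mon (val v) g)).
pose b := (1 - a ^+ 2) / a.
have b0 : 0 < b by rewrite divr_gt0// subr_gt0 exprn_ilt1// ltW.
have bE : normc (a%:C - a%:C^-1) = b.
  rewrite -fmorphV -rmorphB normc_real distrC ger0_norm.
    by rewrite /b; field; rewrite gt_eqF.
  by rewrite subr_ge0 (le_trans (ltW a1))// invf_ge1// ltW.
have f0 : f (mi0 J) = 1 by rewrite /f mult0 !mon0 conjc1 !mul1r.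
(* The majorant is [a] plus [b] times the sum of [|f g|] over nonzero [g], so its bound by 1 leaves
   at most [(1 - a) / b] for that sum; the term at [mi0] adds 1. *)
have bd : abs_bounded f (1 + (1 - a) / b).
  move=> A; have := maj (mi0 J |` A)%fset.
  rewrite (big_fsetD1 (mi0 J)) ?fset1U1//=.
  rewrite (coefs_moebius a01 uoo vE) eqxx monomialE mon0 mulr1 normc_real (ger0_norm (ltW a0)).
  rewrite (_ : ((mi0 J |` A) `\ mi0 J)%fset = (A `\ mi0 J)%fset); last first.
    by apply/fsetP => g; rewrite !inE; case: eqP.
  rewrite (eq_big_seq (fun g => b * normc (f g))); last first.
    move=> g; rewrite !inE => /andP[/negPf g0 _].
    rewrite (coefs_moebius a01 uoo vE) g0 -bE -normcM /f monomialE.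
    by congr normc; ring.
  rewrite -mulr_sumr -lerBrDl mulrC -ler_pdivlMr// => HA.
  apply: (@le_trans _ _ (1 + \sum_(g <- (A `\ mi0 J)%fset) normc (f g))).
    have [A0|A0] := boolP (mi0 J \in A).
      by rewrite (big_fsetD1 (mi0 J))//= f0 normc1.
    have -> : (A `\ mi0 J)%fset = A by apply/fsetP => g; rewrite !inE; case: eqP => // ->; rewrite (negPf A0).
    by rewrite lerDr.
  by rewrite lerD2l.
have := has_csum_norm_le (has_csum_kernel z v) bd.
have innE : inner (val z) (val v) = (a * r)%:C.
  apply: has_csum_csum.
  have := has_csumZ (a * r^-1)%:C (has_csum_sq zoo).
  rewrite -realcM -/r (_ : a * r^-1 * r ^+ 2 = a * r); last by field; rewrite gt_eqF.
  apply: eq_has_csum => j; rewrite vE /u !conjcM !conjc_real realcM; ring.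
have ar1 : 0 < 1 - a * r by rewrite subr_gt0; nra.
rewrite /da_kernel innE div1r normcV.
have -> : 1 - (a * r)%:C = (1 - a * r)%:C :> C by rewrite realcB.
rewrite normc_real (ger0_norm (ltW ar1)).
have -> : 1 + (1 - a) / b = (1 + 2 * a) / (1 + a).
  have -> : b = (1 - a) * (1 + a) / a by rewrite /b; field; rewrite gt_eqF.
  field; rewrite !gt_eqF//; lra.
rewrite ler_pdivlMr; last by lra.
(* [1 + a <= (1 + 2 * a) * (1 - a * r)] amounts to [r * (1 + 2 * a) <= 1], against [ar]. *)
rewrite mulrC ler_pdivrMr//; nra.
Qed.

End BohrOuter.

Theorem theorem2 (R : realType) (d : option nat) (hd : d <> Some 0%N)
    (H : drury_arveson R (axis d)) :
  bohr_set H = [set z : l2ball R (axis d) | l2norm (val z) <= 1 / 3].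
Proof.
by apply/seteqP; split => z; [exact: bohr_set_le|exact: bohr_set_ge].
Qed.
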